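(* Let $A_{\mathbb R}$ be a quiver of continuous type $A$, $k$ a field, and $V$ a pointwise finite-dimensional representation of $A_{\mathbb R}$ over $k$. Then $V$ is a direct sum of interval indecomposables, i.e. $V\cong\bigoplus_{j\in J} M_{I_j}$ for some (possibly infinite) family of intervals $(I_j)_{j\in J}$ of $\mathbb R$.
   Context: A quiver of continuous type $A$, $A_{\mathbb R}=(\mathbb R,S,\preceq)$: $S\subset\mathbb R$ is a discrete, possibly empty, subset with no accumulation points; $\bar S=S\cup\{\pm\infty\}$ with $-\infty<s<+\infty$ for $s\in S$. Elements of $\bar S$ are indexed in an order-preserving way by a subset of $\mathbb Z\cup\{\pm\infty\}$ such that the index $0$ is used, and if $m\le p\le n$ in $\mathbb Z\cup\{\pm\infty\}$ and the indices $m,n$ are used then so is $p$ (so neighbours in $\bar S$ have consecutive integer indices; if $S$ is bounded above, $+\infty$ has an integer index, otherwise $+\infty=s_{+\infty}$; similarly for $-\infty$). The partial order $\preceq$ on $\mathbb R$: $x\preceq y$ iff $x=y$ or there are consecutive $s_n,s_{n+1}\in\bar S$ with $s_n\le x,y\le s_{n+1}$ and [$x\le y$ if $n$ is even; $y\le x$ if $n$ is odd]. So $s_n$ is a sink for $n$ even and a source for $n$ odd. A representation $V$ of $A_{\mathbb R}$ over $k$ assigns to each $x\in\mathbb R$ a $k$-vector space $V(x)$ and to each pair $y\preceq x$ a linear map $V(x,y):V(x)\to V(y)$ with $V(x,x)=\mathrm{id}$ and $V(y,z)\circ V(x,y)=V(x,z)$ for $z\preceq y\preceq x$. Morphisms are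 families of linear maps $f(x):V(x)\to W(x)$ commuting with the structure maps. $V$ is pointwise finite-dimensional if $\dim V(x)<\infty$ for all $x\in\mathbb R$. An interval is a nonempty connected subset of $\mathbb R$. For an interval $I$, $M_I$ is given by $M_I(x)=k$ if $x\in I$ and $0$ otherwise; $M_I(x,y)=1_k$ if $y\preceq x$ and $x,y\in I$, and $0$ otherwise. A representation isomorphic to some $M_I$ is called an interval indecomposable. *)

(* Defs.v *)
From HB Require Import structures.
From mathcomp Require Import all_boot all_order all_algebra.
From mathcomp Require Import zify.
From mathcomp Require Import all_classical all_reals all_analysis.
Import Order.TTheory GRing.Theory Num.Theory.
Import numFieldNormedType.Exports.

Set Implicit Arguments.
Unset Strict Implicit.
Unset Printing Implicit Defensive.

Local Open Scope classical_set_scope.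
Local Open Scope ring_scope.

(* The indexing of [S `|` {-oo, +oo}] by a convex set of extended integers is
   part of the data: the parity of the index of an element of [S] decides
   whether it is a sink or a source.  The values of [quiv_s] outside
   [quiv_idx] are irrelevant. *)
Record ctA_quiver (R : realType) := CtAQuiver {
  quiv_S : set R;
  quiv_S_noacc : limit_point quiv_S = set0;
  quiv_idx : set (\bar int);
  quiv_s : \bar int -> \bar R;
  quiv_s_image : quiv_s @` quiv_idx = EFin @` quiv_S `|` [set -oo%E; +oo%E];
  quiv_s_mono : forall m n, quiv_idx m -> quiv_idx n ->
    (quiv_s m <= quiv_s n)%E = (m <= n)%E;
  quiv_idx0 : quiv_idx 0%E;
  quiv_idx_convex : forall m p n, quiv_idx m -> quiv_idx n ->
    (m <= p)%E -> (p <= n)%E -> quiv_idx p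
}.

Section Quiver.
Variables (R : realType) (Q : ctA_quiver R).

Definition in_piece (n : int) (x : R) : bool :=
  (quiv_s Q n%:E <= x%:E)%E && (x%:E <= quiv_s Q (n + 1)%:E)%E.

(* [qle x y] is the partial order x ⪯ y of the quiver. *)
Definition qle (x y : R) : Prop :=
  x = y \/
  exists n : int,
    [/\ quiv_idx Q n%:E, quiv_idx Q (n + 1)%:E, in_piece n x, in_piece n y
      & if (2 %| n)%Z then x <= y else y <= x].

Lemma qle_refl x : qle x x.
Proof. by left. Qed.

Let piece_lt (m n : int) (x y : R) :
  quiv_idx Q (m + 1)%:E -> quiv_idx Q n%:E ->
  in_piece m x -> in_piece n y -> m < n -> x <= y.
Proof.
move=> dm dn /andP[_ hx] /andP[hy _]; rewrite -lezD1 => mn.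
rewrite -lee_fin (le_trans hx)// (le_trans _ hy)//.
by rewrite (quiv_s_mono dm dn) lee_fin.
Qed.

Let piece_join (m n : int) (y : R) :
  quiv_idx Q (m + 1)%:E -> quiv_idx Q n%:E ->
  in_piece m y -> in_piece n y -> m < n -> n = m + 1.
Proof.
move=> dm dn /andP[_ hm] /andP[hn _] mn; apply/eqP.
rewrite eq_le lezD1 mn andbT -lee_fin -(quiv_s_mono dn dm).
exact: le_trans hn hm.
Qed.

Let odd_succ (m : int) : (2 %| m + 1)%Z = ~~ (2 %| m)%Z.
Proof. lia. Qed.

Lemma qle_trans z y x : qle z y -> qle y x -> qle z x.
Proof.
move=> [<-//|[m [dm dm1 mz my ozy]]] [<-|[n [dn dn1 ny nx oyx]]].
  by right; exists m.
case: (ltgtP m n) => [mn|nm|mn].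
- have nE := piece_join dm1 dn my ny mn.
  have zy := piece_lt dm1 dn mz ny mn; have yx := piece_lt dm1 dn my nx mn.
  rewrite nE odd_succ in oyx; case: ifP ozy oyx => /= pm ozy oyx.
    by have <- : y = x; [apply/eqP; rewrite eq_le yx|right; exists m; rewrite pm].
  have -> : z = y by apply/eqP; rewrite eq_le zy.
  by right; exists n; split => //; rewrite nE odd_succ pm.
- have mE := piece_join dn1 dm ny my nm.
  have yz := piece_lt dn1 dm ny mz nm; have xy := piece_lt dn1 dm nx my nm.
  rewrite mE odd_succ in ozy; case: ifP oyx ozy => /= pn oyx ozy.
    have <- : y = x by apply/eqP; rewrite eq_le xy oyx.
    by right; exists m; split => //; rewrite mE odd_succ pn.
  have -> : z = y by apply/eqP; rewrite eq_le yz ozy.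
  by right; exists n; split => //; rewrite pn.
- rewrite -{}mn in dn dn1 ny nx oyx *; right; exists m; split => //.
  by case: ifP ozy oyx => _ a b; [exact: le_trans a b|exact: le_trans b a].
Qed.

Lemma qle_anti x y : qle x y -> qle y x -> x = y.
Proof.
move=> [//|[m [dm dm1 mx my oxy]]] [//|[n [dn dn1 ny nx oyx]]].
case: (ltgtP m n) => [mn|nm|mn].
- apply/eqP; rewrite eq_le (piece_lt dm1 dn mx ny mn).
  by rewrite (piece_lt dm1 dn my nx mn).
- apply/eqP; rewrite eq_le (piece_lt dn1 dm nx my nm).
  by rewrite (piece_lt dn1 dm ny mx nm).
- by rewrite -mn in oyx; case: ifP oxy oyx => _ a b; apply/eqP; rewrite eq_le a b.
Qed.

Lemma qle_between z y x : qle z y -> qle y x -> z <= y <= x \/ x <= y <= z.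
Proof.
move=> [<-|[m [dm dm1 mz my ozy]]] [<-|[n [dn dn1 ny nx oyx]]].
- by left; rewrite lexx.
- by case: (leP z x) => [|/ltW] zx; [left|right]; rewrite ?lexx ?zx.
- by case: (leP z y) => [|/ltW] zx; [left|right]; rewrite ?lexx ?zx.
case: (ltgtP m n) => [mn|nm|mn].
- by left; rewrite (piece_lt dm1 dn mz ny mn) (piece_lt dm1 dn my nx mn).
- by right; rewrite (piece_lt dn1 dm nx my nm) (piece_lt dn1 dm ny mz nm).
- rewrite -mn in oyx.
  by case: ifP ozy oyx => _ a b; [left|right]; rewrite a b.
Qed.

End Quiver.

Record real_interval (R : realType) := RealInterval {
  ri_set : set R;
  ri_nonempty : ri_set !=set0;
  ri_connected : connected ri_set
}.

(* Direct sum of an arbitrary family of modules: families of finite support. *)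
Section DirectSumModule.
Variables (k : fieldType) (J : Type) (M : J -> lmodType k).

Record dsum_mod := DsumMod {
  dsum_fun :> forall j, M j;
  dsum_fin : finite_set [set j | dsum_fun j != 0]
}.

HB.instance Definition _ := gen_eqMixin dsum_mod.
HB.instance Definition _ := gen_choiceMixin dsum_mod.

Lemma dsum_ext (f g : dsum_mod) : (forall j, f j = g j) -> f = g.
Proof.
case: f g => [f hf] [g hg] /= fg.
have {}fg : f = g by exact: functional_extensionality_dep.
by case: _ / fg hg => hg; congr DsumMod; exact: Prop_irrelevance.
Qed.

Let fin0 : finite_set [set j | (0 : M j) != 0].
Proof. by apply: sub_finite_set (finite_set0 J) => j /=; rewrite eqxx. Qed.
Let finN (f : dsum_mod) : finite_set [set j | - f j != 0].
Proof. by apply: sub_finite_set (dsum_fin f) => j /=; rewrite oppr_eq0. Qed.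
Let finD (f g : dsum_mod) : finite_set [set j | f j + g j != 0].
Proof.
have /(sub_finite_set _) : finite_set
    ([set j | f j != 0] `|` [set j | g j != 0]).
  by rewrite finite_setU; split; exact: dsum_fin.
apply => j /=; case: (eqVneq (f j) 0) => [->|fj _]; last by left.
by rewrite add0r; right.
Qed.
Let finZ (a : k) (f : dsum_mod) : finite_set [set j | a *: f j != 0].
Proof.
apply: sub_finite_set (dsum_fin f) => j /=.
by apply: contra_neq => ->; rewrite scaler0.
Qed.

Definition dsum0 := DsumMod fin0.
Definition dsumN f := DsumMod (finN f).
Definition dsumD f g := DsumMod (finD f g).
Definition dsumZ a f := DsumMod (finZ a f).

Let dsumDA : associative dsumD.
Proof. by move=> f g h; apply: dsum_ext => j /=; rewrite addrA. Qed.
Let dsumDC : commutative dsumD.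
Proof. by move=> f g; apply: dsum_ext => j /=; rewrite addrC. Qed.
Let dsum0D : left_id dsum0 dsumD.
Proof. by move=> f; apply: dsum_ext => j /=; rewrite add0r. Qed.
Let dsumND : left_inverse dsum0 dsumN dsumD.
Proof. by move=> f; apply: dsum_ext => j /=; rewrite addNr. Qed.

HB.instance Definition _ :=
  GRing.isZmodule.Build dsum_mod dsumDA dsumDC dsum0D dsumND.

Let dsumZA a b f : dsumZ a (dsumZ b f) = dsumZ (a * b) f.
Proof. by apply: dsum_ext => j /=; rewrite scalerA. Qed.
Let dsum1Z : left_id 1 dsumZ.
Proof. by move=> f; apply: dsum_ext => j /=; rewrite scale1r. Qed.
Let dsumZDr : right_distributive dsumZ +%R.
Proof. by move=> a f g; apply: dsum_ext => j /=; rewrite scalerDr. Qed.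
Let dsumZDl f : {morph dsumZ^~ f : a b / a + b}.
Proof. by move=> a b; apply: dsum_ext => j /=; rewrite scalerDl. Qed.

HB.instance Definition _ :=
  GRing.Zmodule_isLmodule.Build k dsum_mod dsumZA dsum1Z dsumZDr dsumZDl.

End DirectSumModule.

Section DirectSumMap.
Variables (k : fieldType) (J : Type) (M N : J -> lmodType k).
Variable u : forall j, {linear M j -> N j}.

Let fin_map (f : dsum_mod M) : finite_set [set j | u j (f j) != 0].
Proof.
apply: sub_finite_set (dsum_fin f) => j /=.
by apply: contra_neq => ->; rewrite linear0.
Qed.

Definition dsum_map (f : dsum_mod M) : dsum_mod N := DsumMod (fin_map f).

Let dsum_map_linear : linear dsum_map.
Proof. by move=> a f g; apply: dsum_ext => j /=; rewrite linearP. Qed.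

HB.instance Definition _ :=
  GRing.isLinear.Build k (dsum_mod M) (dsum_mod N) *:%R dsum_map
    dsum_map_linear.

End DirectSumMap.

Section Representations.
Variables (R : realType) (Q : ctA_quiver R) (k : fieldType).

(* [rep_map V h : V x -> V y] for [h : qle Q y x]; that the structure map does
   not depend on the proof [h] is a consequence of proof irrelevance. *)
Record rep := Rep {
  rep_sp :> R -> lmodType k;
  rep_map : forall x y, qle Q y x -> {linear rep_sp x -> rep_sp y};
  rep_map_id : forall x (h : qle Q x x) v, rep_map h v = v;
  rep_map_comp : forall x y z (hyx : qle Q y x) (hzy : qle Q z y)
    (hzx : qle Q z x) v, rep_map hzy (rep_map hyx v) = rep_map hzx v
}.

Definition pwf (V : rep) : Prop :=
  forall x, exists n, inhabited (Vector.axiom n (V x)).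

Record rep_hom (V W : rep) := RepHom {
  hom_fun :> forall x, {linear V x -> W x};
  hom_nat : forall x y (h : qle Q y x) v,
    hom_fun y (rep_map V h v) = rep_map W h (hom_fun x v)
}.

Definition rep_iso (V W : rep) : Prop :=
  exists (f : rep_hom V W) (g : rep_hom W V),
    forall x, cancel (f x) (g x) /\ cancel (g x) (f x).

Section DirectSum.
Variables (J : Type) (M : J -> rep).

Definition dsum_sp (x : R) : lmodType k := dsum_mod (fun j => M j x).
Definition dsum_rep_map x y (h : qle Q y x) : {linear dsum_sp x -> dsum_sp y} :=
  dsum_map (fun j => rep_map (M j) h).

Let dsum_id x (h : qle Q x x) v : dsum_rep_map h v = v.
Proof. by apply: dsum_ext => j /=; rewrite rep_map_id. Qed.
Let dsum_comp x y z (hyx : qle Q y x) (hzy : qle Q z y) (hzx : qle Q z x) v :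
  dsum_rep_map hzy (dsum_rep_map hyx v) = dsum_rep_map hzx v.
Proof. by apply: dsum_ext => j /=; exact: rep_map_comp. Qed.

Definition dsum_rep : rep := Rep dsum_id dsum_comp.

End DirectSum.

Section IntervalRep.
Variable I : real_interval R.

Definition bool_sp (b : bool) : lmodType k :=
  if b then (k^o : lmodType k) else ('rV[k]_0 : lmodType k).
Definition bool_map (b c : bool) : {linear bool_sp b -> bool_sp c} :=
  match b, c return {linear bool_sp b -> bool_sp c} with
  | true, true => idfun
  | _, _ => \0
  end.

Definition itv_sp (x : R) : lmodType k := bool_sp `[< ri_set I x >].
Definition itv_map x y (_ : qle Q y x) : {linear itv_sp x -> itv_sp y} :=
  bool_map `[< ri_set I x >] `[< ri_set I y >].

Let itv_id x (h : qle Q x x) v : itv_map h v = v.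
Proof.
rewrite /itv_map /itv_sp in v *; case: asbool v => //= v.
by rewrite [LHS]thinmx0 [RHS]thinmx0.
Qed.
Let itv_comp x y z (hyx : qle Q y x) (hzy : qle Q z y) (hzx : qle Q z x) v :
  itv_map hzy (itv_map hyx v) = itv_map hzx v.
Proof.
have Iy : `[< ri_set I x >] -> `[< ri_set I z >] -> `[< ri_set I y >].
  move=> /asboolP Ix /asboolP Iz; apply/asboolP.
  have /connected_intervalP cI := @ri_connected _ I.
  by case: (qle_between hzy hyx) => yI; [apply: cI yI|apply: cI yI].
rewrite /itv_map /itv_sp in v *.
move: (asbool _) (asbool _) (asbool _) Iy v => [] [] [] //= Iy v.
  by have := Iy isT isT.
Qed.

Definition itv_rep : rep := Rep itv_id itv_comp.

End IntervalRep.

End Representations.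

(* Main.v *)
(* An interval summand of V is a pair f : M_I -> V, g : V -> M_I with g f = 1.
   A maximal family of pairwise orthogonal summands exists by Zorn; at each point
   only finitely many of them live, so V is their direct sum plus the common
   kernel U of the g's, a subrepresentation.  If U <> 0, an interval summand of U
   contradicts maximality.

   To find an interval summand of V with V(x) <> 0, treat the half-lines at x
   separately.  For y >= x, let E_y (resp. N_y) be the space of values at x of
   sections over [x, y] (resp. of those that vanish at y).  For y <= z one has
   N_y <= N_z <= E_z <= E_y, a chain in V(x).  Its smallest nonzero trace on a
   subspace A determines the end of the interval, and a vector v of it extends to
   a section over that interval.  By duality, functionals prescribed on A extend
   to the interval too.  Doing this on the right with A = V(x), then on the left
   with A the space of vectors that extend to the right, gives v and a functional
   phi with phi(v) = 1 that both extend on both sides.  Passing from finitely many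
   points to infinitely many is linear compactness. *)
Require Import Defs.
From HB Require Import structures.
From mathcomp Require Import all_boot all_order all_algebra.
From mathcomp Require Import all_classical all_reals all_analysis.
From mathcomp Require Import zify lra.
Import Order.TTheory GRing.Theory Num.Theory.
Import numFieldNormedType.Exports.

Set Implicit Arguments.
Unset Strict Implicit.
Unset Printing Implicit Defensive.

Local Open Scope classical_set_scope.
Local Open Scope ring_scope.

(** * Linear algebra: subspaces, directed affine families, functionals *)

Lemma linear_of (k : fieldType) (M N : lmodType k) (f : M -> N) : linear f ->
  exists h : {linear M -> N}, h =1 f.
Proof.
move=> lf.
pose F : {linear M -> N} := HB.pack f (GRing.isLinear.Build _ _ _ _ f lf).
by exists F.
Qed.

Lemma hom_of_linear (k : fieldType) (U W : vectType k) (f : U -> W) :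
  linear f -> exists h : 'Hom(U, W), h =1 f.
Proof. by move=> /linear_of[F FE]; exists (linfun F) => v; rewrite lfunE. Qed.

Section LinearAlgebra.
Variable k : fieldType.

Definition lclosed (M : lmodType k) (P : M -> Prop) :=
  P 0 /\ forall a u v, P u -> P v -> P (a *: u + v).

Definition affine (M : lmodType k) (P : M -> Prop) :=
  forall a u v w, P u -> P v -> P w -> P (u + a *: (v - w)).

Lemma lclosed_affine (M : lmodType k) (P : M -> Prop) : lclosed P -> affine P.
Proof.
move=> [P0 PD] a u v w Pu Pv Pw; rewrite addrC; apply: (PD) => //.
by rewrite addrC -scaleN1r; apply: PD.
Qed.

(** A subspace of maximal dimension inside [P] absorbs each vector of [P], since adding its line
    stays inside [P]. *)
Lemma vspace_of_lclosed (V : vectType k) (P : V -> Prop) :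
  lclosed P -> exists U : {vspace V}, forall v, v \in U <-> P v.
Proof.
move=> [P0 PD]; pose good (U : {vspace V}) := forall v : V, v \in U -> P v.
pose Q n := `[< exists2 U : {vspace V}, good U & \dim U = n >].
have Q0 : exists n, Q n.
  exists 0%N; apply/asboolP; exists 0%VS; last exact: dimv0.
  by move=> v; rewrite memv0 => /eqP->.
have Qle n : Q n -> (n <= \dim {:V})%N.
  by move=> /asboolP[U _ <-]; apply/dimvS/subvf.
case: (ex_maxnP Q0 Qle) => n /asboolP[U gU Un] nmax.
exists U => v; split=> [|Pv]; first exact: gU.
have gUv : good (U + <[v]>)%VS.
  move=> _ /memv_addP[u uU [_ /vlineP[a ->] ->]].
  by rewrite addrC; apply: PD => //; apply: gU.
have := nmax _ (asboolT (ex_intro2 _ _ _ gUv erefl)).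
rewrite -Un => UvU; have /eqP -> : U == (U + <[v]>)%VS.
  by rewrite eqEdim addvSl.
by rewrite (subvP (addvSr _ _)) ?memv_line.
Qed.

Lemma affine_vspace (V : vectType k) (P : V -> Prop) v0 : affine P -> P v0 ->
  exists U : {vspace V}, forall v, v \in U <-> P (v0 + v).
Proof.
move=> affP P0; apply: vspace_of_lclosed; split; first by rewrite addr0.
move=> a u v Pu Pv; have := affP a _ _ _ Pv Pu P0.
by rewrite (addrC v0 u) addrK -addrA (addrC v).
Qed.

(** Take [W i] with direction space of minimal dimension. A member [W l] inside both [W i] and [W j]
    then has the same direction space as [W i], so [W i] and [W l] coincide. *)
Lemma affine_min (V : vectType k) (I : Type) (W : I -> V -> Prop) (i0 : I) :
  (forall i, affine (W i)) -> (forall i, exists v, W i v) ->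
  (forall i j, exists l, forall v, W l v -> W i v /\ W j v) ->
  exists i, forall j v, W i v -> W j v.
Proof.
move=> affW /choice[w Ww] dirW.
have /choice[U UP] i := affine_vspace (affW i) (Ww i).
pose Q n := `[< exists i, \dim (U i) = n >].
have exQ : exists n, Q n by exists (\dim (U i0)); apply/asboolP; exists i0.
case: (ex_minnP exQ) => n /asboolP[i <-] imin.
exists i => j v Wv; have [l lP] := dirW i j; apply: (lP v _).2.
have wl := (lP _ (Ww l)).1.
have sub : (U l <= U i)%VS.
  apply/subvP => u /UP/lP[Wu _]; apply/UP.
  have := affW i 1 _ _ _ (Ww i) Wu wl.
  by rewrite scale1r addrAC subrr add0r.
have /eqP eU : U l == U i.
  by rewrite eqEdim sub; apply: imin; apply/asboolP; exists l.
have -> : v = w l + (v - w l) by rewrite addrC subrK.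
apply/UP; rewrite eU; apply/UP.
by have := affW i 1 _ _ _ (Ww i) Wv wl; rewrite scale1r.
Qed.

(** Uniqueness at 0 makes the linear relation [G] the graph of a functional on its domain.
    Coordinates along a basis of that domain are defined on all of [V] and extend it. *)
Lemma functional_extend (V : vectType k) (G : V -> k -> Prop) :
  G 0 0 ->
  (forall a u v c d, G u c -> G v d -> G (a *: u + v) (a * c + d)) ->
  (forall c, G 0 c -> c = 0) ->
  exists phi : 'Hom(V, k^o), forall v c, G v c -> phi v = c.
Proof.
move=> G0 GD Guniq.
have [U UP] : exists U : {vspace V}, forall v, v \in U <-> exists c, G v c.
  apply: vspace_of_lclosed; split; first by exists 0.
  by move=> a u v [c Gu] [d Gv]; exists (a * c + d); apply: GD.
have GE v c d : G v c -> G v d -> c = d.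
  move=> Gc Gd; have := GD (-1) _ _ _ _ Gd Gc.
  rewrite scaleN1r addNr mulN1r => /Guniq/eqP.
  by rewrite addrC subr_eq0 => /eqP.
have /choice[c cP] (i : 'I_(\dim U)) : exists c, G (vbasis U)`_i c.
  by apply/UP/vbasis_mem/mem_nth; rewrite size_tuple.
exists (\sum_i c i *: linfun (coord (vbasis U) i : V -> k^o)) => v d Gv.
have vU : v \in U by apply/UP; exists d.
apply/(GE v)/Gv; rewrite {1}(coord_vbasis vU) sum_lfunE.
elim/big_ind2: _ => [//|u a v' b Gu Gb|i _].
  by have := GD 1 _ _ _ _ Gu Gb; rewrite scale1r mul1r.
have := GD (coord (vbasis U) i v) _ _ _ _ (cP i) G0.
by rewrite !addr0 scale_lfunE lfunE /= mulrC.
Qed.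

End LinearAlgebra.

(* Linear compactness of products of finite-dimensional spaces.  By Zorn, take
   a maximal partial assignment compatible with every finite subsystem; the
   values allowed at one more point by the finite subsystems form a directed
   family of nonempty affine subspaces, which has a least member. *)
Section Compactness.
Variables (k : fieldType) (T : eqType) (V : T -> vectType k) (x0 : T).
Variables (P : V x0 -> Prop) (C : forall x y, V x -> V y -> Prop).
Hypothesis affP : affine P.
Hypothesis affC : forall a x y u1 u2 v1 v2 w1 w2, C u1 u2 -> C v1 v2 -> C w1 w2 ->
  @C x y (u1 + a *: (v1 - w1)) (u2 + a *: (v2 - w2)).

Let sol (Y : seq T) (s : forall x, V x) :=
  P (s x0) /\ forall x y, x \in Y -> y \in Y -> C (s x) (s y).
Let agree (L : seq {x & V x}) (s : forall x, V x) :=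
  forall p, p \in L -> s (tag p) = tagged p.
(** A partial assignment is given by its graph; lists of two elements show that a good [G] is
    single-valued. *)
Let good (G : set {x & V x}) := forall Y L, (forall p, p \in L -> G p) ->
  exists2 s, sol Y s & agree L s.

Lemma compactness : (forall Y, exists s, sol Y s) ->
  exists s : forall x, V x, P (s x0) /\ forall x y, C (s x) (s y).
Proof.
move=> finsol.
have [F subF totF|G [gG Gmax]] := @Zorn_bigcup _ good.
  move=> Y L LF.
  (* Finitely many values from the union of a chain lie in one member of it; the empty list also
     covers the empty chain. *)
  have [L0|[B FB LB]] : L = [::] \/ exists2 B, F B & forall p, p \in L -> B p.
    elim: L LF => [|p L IH] LF; [by left|right].
    have [B FB Bp] := LF p (mem_head _ _).
    have [|->|[B' FB' LB']] := IH.
    - by move=> q qL; apply: LF; rewrite in_cons qL orbT.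
    - by exists B => // q; rewrite mem_seq1 => /eqP->.
    have [BB'|B'B] := totF _ _ FB FB'.
      exists B' => // q; rewrite in_cons => /orP[/eqP->|]; first exact: BB'.
      exact: LB'.
    by exists B => // q; rewrite in_cons => /orP[/eqP->//|/LB'/B'B].
  - by have [s sY] := finsol Y; exists s => //; rewrite L0.
  exact: (subF _ FB).
have total (x : T) : exists w : V x, G (Tagged V w).
  pose I := {YL : seq T * seq {x & V x} | forall p, p \in YL.2 -> G p}.
  (* The values at [x] allowed by the finite subsystem [i]. A value in the least of these sets is
     allowed by all, so it can be added to [G]. *)
  pose W (i : I) (w : V x) := exists2 s, sol (sval i).1 s /\ agree (sval i).2 s & s x = w.
  have i0 : I by exists ([::], [::]).
  have [i|i|i j|i imin] := @affine_min _ _ I W i0.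
  - move=> a _ _ _ [s1 [[P1 S1] A1] <-] [s2 [[P2 S2] A2] <-] [s3 [[P3 S3] A3] <-].
    exists (fun y => s1 y + a *: (s2 y - s3 y)) => //; split; first split.
    + exact: affP.
    + by move=> y z yY zY; apply: affC; [apply: S1|apply: S2|apply: S3].
    by move=> p pL; rewrite A1 // A2 // A3 // subrr scaler0 addr0.
  - have [s ? ?] := gG (sval i).1 _ (svalP i).
    by exists (s x), s.
  - have GL p : p \in (sval i).2 ++ (sval j).2 -> G p.
      by rewrite mem_cat => /orP[/(svalP i)|/(svalP j)].
    pose l : I := exist _ ((sval i).1 ++ (sval j).1, (sval i).2 ++ (sval j).2) GL.
    exists l => _ [s [[Ps Ss] As] <-]; split; exists s => //; split=> /=.
    + by split=> // y z yY zY; apply: Ss; rewrite mem_cat ?yY ?zY.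
    + by move=> p pL; apply: As; rewrite mem_cat pL.
    + by split=> // y z yY zY; apply: Ss; rewrite mem_cat ?yY ?zY orbT.
    + by move=> p pL; apply: As; rewrite mem_cat pL orbT.
  have [s0 ? ?] := gG (sval i).1 _ (svalP i).
  exists (s0 x); pose G' := G `|` [set Tagged V (s0 x)].
  have gG' : good G'.
    move=> Y L LG'.
    have GL p : p \in [seq p <- L | p != Tagged V (s0 x)] -> G p.
      rewrite mem_filter => /andP[/eqP np pL].
      by have [//|/= E] := LG' p pL.
    pose j : I := exist _ (Y, [seq p <- L | p != Tagged V (s0 x)]) GL.
    have [|s [/= Ss As] sx] := imin j (s0 x); first by exists s0.
    exists s => // p pL; have [->//|pN] := eqVneq p (Tagged V (s0 x)).
    by apply: As; rewrite mem_filter pN.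
  apply: contrapT => nG; apply: (Gmax G') gG'; split; first by left.
  by move=> sub; apply: nG; apply: sub; right.
pose s x : V x := sval (cid (total x)).
have sG x : G (Tagged V (s x)) by apply: svalP (cid (total x)).
have GL (Y : seq T) p : p \in [seq Tagged V (s y) | y <- Y] -> G p.
  by move=> /mapP[y _ ->].
have sE Y : exists2 s', sol Y s' & forall y, y \in Y -> s' y = s y.
  have [s' s'Y A] := gG Y _ (@GL Y).
  by exists s' => // y yY; apply: (A (Tagged V (s y))); apply: map_f.
exists s; split=> [|x y].
  have [s' [Ps' _] E] := sE [:: x0].
  by rewrite -E ?mem_head.
have [s' [_ Ss'] E] := sE [:: x; y].
by rewrite -!E ?inE ?eqxx ?orbT //; apply: Ss'; rewrite ?inE ?eqxx ?orbT.
Qed.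

End Compactness.

(* What the proof uses of the orientation [ord] of the line [le]; it is stable
   under reversing the arrows (duality) and under reversing the line. *)
Record line_quiver (T : Type) (le : rel T) (ord : T -> T -> Prop) : Prop := {
  lq_refl : reflexive le;
  lq_trans : transitive le;
  lq_anti : antisymmetric le;
  lq_total : total le;
  lq_ordxx : forall x, ord x x;
  lq_ord_trans : forall z y x, ord z y -> ord y x -> ord z x;
  lq_down : forall x y z, le x y -> le y z -> ord x z -> ord x y /\ ord y z;
  lq_up : forall x y z, le x y -> le y z -> ord z x -> ord z y /\ ord y x;
  lq_ind : forall Q : T -> T -> Prop,
    (forall x y, le x y -> ord x y \/ ord y x -> Q x y) ->
    (forall x y z, le x y -> le y z -> Q x y -> Q y z -> Q x z) ->
    forall x y, le x y -> Q x y
}.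

Lemma line_quiver_op (T : Type) (le : rel T) (ord : T -> T -> Prop) :
  line_quiver le ord -> line_quiver le (fun x y => ord y x).
Proof.
case=> r t a to o ot d u ind; split=> //.
- by move=> z y x yz xy; apply: ot xy yz.
- by move=> x y z xy yz xz; have [] := u _ _ _ xy yz xz.
- by move=> x y z xy yz xz; have [] := d _ _ _ xy yz xz.
- by move=> Q Q1 Q2; apply: ind => // x y xy h; apply: Q1 => //; case: h; [right|left].
Qed.

Lemma line_quiver_flip (T : Type) (le : rel T) (ord : T -> T -> Prop) :
  line_quiver le ord -> line_quiver (fun x y => le y x) ord.
Proof.
case=> r t a to o ot d u ind; split=> //.
- by move=> y x z yx zy; exact: t zy yx.
- by move=> x y yx; apply: a; rewrite andbC.
- by move=> x y z yx zy xz; have [] := u _ _ _ zy yx xz.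
- by move=> x y z yx zy xz; have [] := d _ _ _ zy yx xz.
- move=> Q Q1 Q2 x y yx; apply: (ind (fun a b => Q b a)) yx.
    by move=> a' b ab h; apply: Q1 => //; case: h; [right|left].
  by move=> a' b c ab bc Qba Qcb; apply: Q2 Qcb Qba.
Qed.

(** * Sections over parts of the line: gluing, compactness, extension by zero *)

Section Coherent.
Variables (T : Type) (le : rel T) (ord : T -> T -> Prop) (V : T -> Type).
Variable m : forall x y, V x -> V y.

(** Sources range over [D] and targets over [E]: with [E] larger than [D] and [s] zero outside [D],
    arrows from [D] to the rest of [E] must kill [s]. *)
Definition coherent (D E : pred T) (s : forall x, V x) :=
  forall u w, D u -> E w -> ord w u -> @m u w (s u) = s w.

Lemma coherentS (D E D' E' : pred T) s : subpred D' D -> subpred E' E ->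
  coherent D E s -> coherent D' E' s.
Proof. by move=> DD EE c u w /DD Du /EE Ew; apply: c. Qed.

Hypothesis LQ : line_quiver le ord.
Hypothesis mcomp : forall x y z, ord y x -> ord z y ->
  forall v : V x, m z (m y v) = m z v.

(** An arrow across [y] factors through [y] by [lq_down] or [lq_up], and [s] and [t] agree there. *)
Lemma coherent_glue y (D1 E1 D2 E2 : pred T) s t :
  (forall u, D1 u || E1 u -> le u y) -> (forall u, D2 u || E2 u -> le y u) ->
  [&& D1 y, E1 y, D2 y & E2 y] -> s y = t y ->
  coherent D1 E1 s -> coherent D2 E2 t ->
  exists r, [/\ forall u, le u y -> r u = s u, forall u, le y u -> r u = t u &
    coherent (predU D1 D2) (predU E1 E2) r].
Proof.
move=> le1 le2 /and4P[D1y E1y D2y E2y] sty cs ct.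
pose r u := if le u y then s u else t u.
have rs u : le u y -> r u = s u by rewrite /r => ->.
have rt u : le y u -> r u = t u.
  rewrite /r; case: ifP => // uy yu.
  by have -> : u = y by apply: (lq_anti LQ); rewrite uy.
exists r; split=> // u w /orP[Du|Du] /orP[Ew|Ew] ouw.
- by rewrite !rs ?le1 ?Du ?Ew ?orbT //; apply: cs.
- have uy : le u y by rewrite le1 ?Du.
  have yw : le y w by rewrite le2 ?Ew ?orbT.
  have [owy oyu] := lq_up LQ uy yw ouw.
  by rewrite (rs _ uy) (rt _ yw) -(mcomp oyu owy) (cs u y) // sty; apply: ct.
- have yu : le y u by rewrite le2 ?Du.
  have wy : le w y by rewrite le1 ?Ew ?orbT.
  have [owy oyu] := lq_down LQ wy yu ouw.
  by rewrite (rt _ yu) (rs _ wy) -(mcomp oyu owy) (ct u y) // -sty; apply: cs.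
- by rewrite !rt ?le2 ?Du ?Ew ?orbT //; apply: ct.
Qed.

End Coherent.

Lemma seq_extremum (T : eqType) (r : rel T) (K : pred T) y0 (Y : seq T) :
  reflexive r -> transitive r -> total r -> K y0 ->
  exists2 y, K y & forall z, z \in Y -> K z -> r z y.
Proof.
move=> rr tr tot K0; elim: Y => [|x Y [y Ky IH]]; first by exists y0.
have [Kx|nKx] := boolP (K x); last first.
  by exists y => // z /[1!inE] /orP[/eqP->|/IH//]; rewrite (negPf nKx).
have [xy|yx] := orP (tot x y).
  by exists y => // z /[1!inE] /orP[/eqP->//|/IH].
exists x => // z /[1!inE] /orP[/eqP->//|zY Kz].
exact: tr (IH _ zY Kz) yx.
Qed.

Section LinearCoherent.
Variables (k : fieldType) (T : eqType) (ord : T -> T -> Prop).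
Variables (V : T -> vectType k) (m : forall x y, V x -> V y).
Hypothesis mlin : forall x y, linear (@m x y).

Let m0 x y : @m x y 0 = 0.
Proof. by have := @mlin x y (-1) 0 0; rewrite scaleN1r addNr scaleN1r addNr. Qed.

Lemma coherent0 (D E : pred T) : coherent ord m D E (fun x => 0).
Proof. by move=> u w _ _ _; apply: m0. Qed.

Lemma coherentD (D E : pred T) a s t : coherent ord m D E s ->
  coherent ord m D E t -> coherent ord m D E (fun x => a *: s x + t x).
Proof. by move=> cs ct u w Du Ew o; rewrite mlin cs ?ct. Qed.

(** Coherence and vanishing outside [F] bind at most two points at a time, so [compactness]
    applies. *)
Lemma coherent_extend x0 (P : V x0 -> Prop) (D E F : pred T) : affine P ->
  (forall Y : seq T, exists s, [/\ P (s x0),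
     coherent ord m [pred x in Y | D x] [pred x in Y | E x] s
     & forall x, x \in Y -> ~~ F x -> s x = 0]) ->
  exists s, [/\ P (s x0), coherent ord m D E s & forall x, ~~ F x -> s x = 0].
Proof.
move=> affP fin.
pose C x y (u : V x) (v : V y) :=
  (D x -> E y -> ord y x -> m y u = v) /\ (~~ F x -> u = 0).
have [||s [Ps Cs]] := @compactness k T V x0 P C affP.
- move=> a x y u1 u2 v1 v2 w1 w2 [u F1] [v F2] [w F3]; split=> [Dx Ey o|nF].
    rewrite -(u Dx Ey o) -(v Dx Ey o) -(w Dx Ey o).
    by rewrite [u1 + _]addrC mlin [v1 - _]addrC -scaleN1r mlin scaleN1r addrC [- _ + _]addrC.
  by rewrite F1 // F2 // F3 // subrr scaler0 addr0.
- move=> Y; have [s [Ps cs Fs]] := fin Y; exists s; split=> // x y xY yY.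
  by split=> [Dx Ey o|]; [apply: cs => //=; apply/andP|apply: Fs].
exists s; split=> // [x y Dx Ey o|x nF]; first by apply: (Cs x y).1.
by apply: (Cs x x).2.
Qed.

(** No arrow leads from [D] to the rest of [E], so zero values there break no condition. *)
Lemma coherent_cut (D E : pred T) s : coherent ord m D D s ->
  (forall u w, D u -> E w -> ~~ D w -> ~ ord w u) ->
  coherent ord m D E (fun x => if D x then s x else 0).
Proof.
move=> cs out u w Du Ew o; rewrite Du; case: ifP => [Dw|/negbT nDw].
  exact: cs.
by case: (out _ _ Du Ew nDw).
Qed.

End LinearCoherent.

(** * Representations of a line and their duals *)

Definition itv (T : Type) (le : rel T) (x y : T) : pred T :=
  fun u => le x u && le u y.

Section LineRep.
Variables (k : fieldType) (T : eqType) (le : rel T) (ord : T -> T -> Prop).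
Variables (V : T -> vectType k) (m : forall x y, 'Hom(V x, V y)).

(** The maps are total in both points, to avoid dependence on proofs of [ord]; the laws constrain
    comparable points alone. *)
Definition linerep_axiom := (forall x (v : V x), m x x v = v) /\
  (forall x y z, ord y x -> ord z y -> forall v, m y z (m x y v) = m x z v).

(** Precomposition with [m y x]: the dual spaces represent the line with all arrows reversed. *)
Definition dual_map x y (phi : 'Hom(V x, k^o)) : 'Hom(V y, k^o) :=
  (phi \o m y x)%VF.

Definition coh (D E : pred T) (s : forall x, V x) :=
  coherent ord (fun x y => m x y) D E s.
Definition dcoh (D E : pred T) (g : forall x, 'Hom(V x, k^o)) :=
  coherent (fun x y => ord y x) dual_map D E g.

Lemma dual_map_linear x y : linear (@dual_map x y).
Proof. by move=> a u v; rewrite /dual_map comp_lfunDl comp_lfunZl. Qed.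

Lemma dcohP (D E : pred T) g : dcoh D E g <->
  forall u w, D u -> E w -> ord u w -> forall v, g w v = g u (m w u v).
Proof.
split=> [c u w Du Ew o v|c u w Du Ew o]; first by rewrite -(c u w) ?lfunE.
by apply/lfunP => v; rewrite lfunE /= -c.
Qed.

Let mlin x y : linear (m x y). Proof. by move=> a u v; rewrite linearP. Qed.

Lemma coh0 (D E : pred T) : coh D E (fun=> 0).
Proof. exact: coherent0 mlin _ _. Qed.

Lemma cohD (D E : pred T) a s t : coh D E s -> coh D E t ->
  coh D E (fun x => a *: s x + t x).
Proof. exact: coherentD mlin _ _ _ _ _. Qed.

Hypothesis LQ : line_quiver le ord.
Hypothesis mP : linerep_axiom.

Let mid := mP.1.
Let mcomp := mP.2.

Lemma dual_map_comp x y z : ord x y -> ord y z -> forall phi : 'Hom(V x, k^o),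
  dual_map z (dual_map y phi) = dual_map z phi.
Proof.
by move=> xy yz phi; apply/lfunP => v; rewrite !lfunE /= !lfunE /= mcomp.
Qed.

Let lexx := lq_refl LQ.

Local Notation Itv := (itv le).

Let coh_glue x y z s t : le x y -> le y z -> s y = t y ->
  coh (Itv x y) (Itv x y) s -> coh (Itv y z) (Itv y z) t ->
  exists r, [/\ forall u, le u y -> r u = s u, forall u, le y u -> r u = t u &
    coh (Itv x z) (Itv x z) r].
Proof.
move=> xy yz st cs ct.
have [|||r [rs rt cr]] := coherent_glue LQ mcomp (y := y) _ _ _ st cs ct.
- by move=> u; rewrite orbb => /andP[].
- by move=> u; rewrite orbb => /andP[].
- by rewrite /itv !lexx xy yz.
exists r; split=> //; apply: coherentS cr => u /andP[xu uz]; rewrite /= /itv xu uz.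
  by rewrite !andbT; apply: (lq_total LQ).
by rewrite !andbT; apply: (lq_total LQ).
Qed.

Let dcoh_glue x y z s t : le x y -> le y z -> s y = t y ->
  dcoh (Itv x y) (Itv x y) s -> dcoh (Itv y z) (Itv y z) t ->
  exists r, [/\ forall u, le u y -> r u = s u, forall u, le y u -> r u = t u &
    dcoh (Itv x z) (Itv x z) r].
Proof.
move=> xy yz st cs ct.
have [|||r [rs rt cr]] :=
  coherent_glue (line_quiver_op LQ) dual_map_comp (y := y) _ _ _ st cs ct.
- by move=> u; rewrite orbb => /andP[].
- by move=> u; rewrite orbb => /andP[].
- by rewrite /itv !lexx xy yz.
exists r; split=> //; apply: coherentS cr => u /andP[xu uz]; rewrite /= /itv xu uz.
  by rewrite !andbT; apply: (lq_total LQ).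
by rewrite !andbT; apply: (lq_total LQ).
Qed.

(* Linear relations satisfy (C2 o C1)^* = C2^* o C1^*: a pair of functionals that
   agree on the end values of all sections over [x, y] is the pair of end values
   of a section of the dual over [x, y]. *)
Lemma dual_section x y : le x y ->
  forall (phi : 'Hom(V x, k^o)) (gam : 'Hom(V y, k^o)),
  (forall s, coh (Itv x y) (Itv x y) s -> phi (s x) = gam (s y)) ->
  exists g, [/\ dcoh (Itv x y) (Itv x y) g, g x = phi & g y = gam].
Proof.
elim/(lq_ind LQ): x y /.
  (* Along a single arrow, one of the two functionals is transported over the interval; [H] on
     transported vectors gives the value at the other end. *)
  move=> x y xy [oxy|oyx] phi gam H.
    exists (fun u => dual_map u phi); split.
    + apply/dcohP => u w /andP[xu uy] /andP[xw wy] ouw v.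
      rewrite !lfunE /= mcomp //.
      by have [] := lq_down LQ xu uy oxy.
    + by apply/lfunP => v; rewrite lfunE /= mid.
    apply/lfunP => b; rewrite lfunE /= (H (fun u => m y u b)) ?mid //.
    move=> u w /andP[xu uy] /andP[xw wy] owu; rewrite mcomp //.
    by have [] := lq_down LQ xu uy oxy.
  exists (fun u => dual_map u gam); split.
  + apply/dcohP => u w /andP[xu uy] /andP[xw wy] ouw v.
    rewrite !lfunE /= mcomp //.
    by have [] := lq_up LQ xu uy oyx.
  + apply/lfunP => a; rewrite lfunE /= -(H (fun u => m x u a)) ?mid //.
    move=> u w /andP[xu uy] /andP[xw wy] owu; rewrite mcomp //.
    by have [] := lq_up LQ xu uy oyx.
  by apply/lfunP => v; rewrite lfunE /= mid.
move=> x y z xy yz IH1 IH2 phi gam H.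
(* The functional [mu] at [y] must send [s y] to [phi (s x)] and [t y] to [gam (t z)]. It is well
   defined: if [s y + t y = 0], then [s] glues with [- t] and [H] applies. *)
pose G b c := exists s t, [/\ coh (Itv x y) (Itv x y) s,
  coh (Itv y z) (Itv y z) t, b = s y + t y & c = phi (s x) + gam (t z) :> k].
have [|||mu muP] := @functional_extend k (V y) G.
- exists (fun=> 0), (fun=> 0); rewrite !linear0 !addr0.
  by split=> //; apply: coh0.
- move=> a _ _ _ _ [s [t [cs ct -> ->]]] [s' [t' [cs' ct' -> ->]]].
  exists (fun u => a *: s u + s' u), (fun u => a *: t u + t' u); split.
  + exact: cohD.
  + exact: cohD.
  + by rewrite scalerDr addrACA.
  by rewrite !linearP mulrDr addrACA.
- move=> c [s [t [cs ct st ->]]].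
  have [||r [rs rt cr]] := coh_glue xy yz _ cs
    (t := fun u => (-1) *: t u + 0).
  + by rewrite addr0 scaleN1r; apply/eqP; rewrite -addr_eq0 -st.
  + by apply: cohD => //; apply: coh0.
  have := H r cr; rewrite rs // rt // => ->.
  by rewrite addr0 scaleN1r linearN addNr.
have [|g1 [c1 g1x g1y]] := IH1 phi mu.
  move=> s cs; apply/esym/muP; exists s, (fun=> 0).
  rewrite !linear0 !addr0; split=> //.
  exact: coh0.
have [|g2 [c2 g2x g2y]] := IH2 mu gam.
  move=> t ct; apply/muP; exists (fun=> 0), t.
  rewrite !linear0 !add0r; split=> //.
  exact: coh0.
have [|g [gs gt cg]] := dcoh_glue xy yz _ c1 c2; first by rewrite g1y g2x.
by exists g; rewrite gs // gt.
Qed.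

End LineRep.

(** * Extension of vectors and functionals along a half-line *)

Definition initial_segment (T : Type) (le : rel T) (x0 : T) (D : pred T) :=
  [/\ D x0, forall y, D y -> le x0 y &
    forall y z, le x0 y -> le y z -> D z -> D y].

Section OneSide.
Variables (k : fieldType) (T : eqType) (le : rel T) (ord : T -> T -> Prop).
Variables (V : T -> vectType k) (m : forall x y, 'Hom(V x, V y)).
Hypothesis LQ : line_quiver le ord.
Hypothesis mP : linerep_axiom ord m.
Variables (x0 : T) (A : {vspace V x0}).

Let mid := mP.1.
Let mcomp := mP.2.
Let lexx := lq_refl LQ.
Let mlin x y : linear (m x y). Proof. by move=> a u v; rewrite linearP. Qed.
Let dlin x y : linear (@dual_map k T V m x y).
Proof. by move=> *; apply: dual_map_linear. Qed.

Local Notation Itv := (itv le).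
Local Notation coh := (coh ord m).
Local Notation dcoh := (dcoh ord (V := V) m).

Let N y a := exists s, [/\ coh (Itv x0 y) (Itv x0 y) s, s x0 = a & s y = 0].
Let E y a := exists2 s, coh (Itv x0 y) (Itv x0 y) s & s x0 = a.
Let meet (P : V x0 -> Prop) := exists a, [/\ a \in A, a != 0 & P a].

Let lclosedN y : lclosed (N y).
Proof.
split; first by exists (fun=> 0); split=> //; apply: coh0.
move=> a u v [s [cs su s0]] [t [ct tv t0]].
exists (fun x => a *: s x + t x); split; first exact: cohD.
  by rewrite su tv.
by rewrite s0 t0 scaler0 addr0.
Qed.

Let lclosedE y : lclosed (E y).
Proof.
split; first by exists (fun=> 0) => //; apply: coh0.
move=> a u v [s cs su] [t ct tv].
exists (fun x => a *: s x + t x); first exact: cohD.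
by rewrite su tv.
Qed.

Let sub_itv y z : le y z -> subpred (Itv x0 y) (Itv x0 z).
Proof. by move=> yz u /andP[xu uy]; rewrite /itv xu (lq_trans LQ uy yz). Qed.

Let N_global y a : le x0 y -> N y a ->
  exists s, [/\ coh (le x0) (le x0) s, s x0 = a & forall z, le y z -> s z = 0].
Proof.
move=> xy [s [cs sx sy]].
have [|||r [rs rt cr]] := coherent_glue LQ mcomp (y := y) _ _ _ sy cs
  (@coh0 k T ord V m (le y) (le y)).
- by move=> u; rewrite orbb => /andP[].
- by move=> u; rewrite orbb.
- by rewrite /itv !lexx xy.
exists r; split; [|by rewrite rs|by []].
apply: coherentS cr => u xu; rewrite /= /itv xu;
by apply: (lq_total LQ).
Qed.

Let N_mono y z a : le x0 y -> le y z -> N y a -> N z a.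
Proof.
move=> xy yz /(N_global xy)[s [cs sx s0]]; exists s; split=> //.
- by apply: coherentS cs => u /andP[].
- exact: s0.
Qed.

Let E_mono y z a : le y z -> E z a -> E y a.
Proof.
by move=> yz [s cs sx]; exists s => //; apply: coherentS cs; apply: sub_itv.
Qed.

Let meetS P Q : (forall a, P a -> Q a) -> meet P -> meet Q.
Proof. by move=> PQ [a [? ? /PQ]]; exists a. Qed.

(** The traces on [A] form a chain of nonzero subspaces, which has a smallest member by finite
    dimension. The chain increases for [N] and decreases for [E]. *)
Let meet_min (K : pred T) (P : T -> V x0 -> Prop) y0 : K y0 ->
  (forall y, lclosed (P y)) -> (forall y, K y -> meet (P y)) ->
  (forall y z, le y z -> K y -> K z ->
     (forall a, P y a -> P z a) \/ (forall a, P z a -> P y a)) ->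
  exists v, [/\ v \in A, v != 0 & forall y, K y -> P y v].
Proof.
move=> K0 Pl PA Pc; pose I := {y | K y}.
pose W (i : I) a := a \in A /\ P (sval i) a.
have [i|i|i j|i imin] := @affine_min k (V x0) I W (exist _ y0 K0).
- apply: lclosed_affine; split; first by split; [apply: mem0v|apply: (Pl _).1].
  move=> a u v [uA Pu] [vA Pv]; split; first by rewrite memvD ?memvZ.
  exact: (Pl _).2.
- by exists 0; split; [apply: mem0v|apply: (Pl _).1].
- have [PS|PS] : (forall a, P (sval i) a -> P (sval j) a) \/
      (forall a, P (sval j) a -> P (sval i) a).
    case: i j => [y Ky] [z Kz] /=; have [yz|zy] := orP (lq_total LQ y z).
      exact: Pc.
    by have [|] := Pc _ _ zy Kz Ky; [right|left].
  + by exists i => v [vA Pv]; do !split=> //; apply: PS.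
  + by exists j => v [vA Pv]; do !split=> //; apply: PS.
have [v [vA v0 Pv]] := PA _ (svalP i).
exists v; split=> // y Ky.
by have [] := imin (exist _ y Ky) v (conj vA Pv).
Qed.

(** The sum of [A] and [P] is direct, so [psi] on [A] and 0 on [P] fit together. *)
Let extend_avoiding (P : V x0 -> Prop) (psi : 'Hom(V x0, k^o)) :
  lclosed P -> ~ meet P -> exists phi : 'Hom(V x0, k^o),
  (forall a, a \in A -> phi a = psi a) /\ (forall a, P a -> phi a = 0).
Proof.
move=> [P0 PD] nP.
have PN b : P b -> P (- b).
  by move=> Pb; rewrite -[- b]addr0 -scaleN1r; apply: PD.
pose G b (c : k) := exists a n, [/\ a \in A, P n, b = a + n & c = psi a].
have [|||phi phiP] := @functional_extend k (V x0) G.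
- by exists 0, 0; rewrite mem0v linear0 addr0.
- move=> a _ _ _ _ [u [n [uA Pn -> ->]]] [u' [n' [uA' Pn' -> ->]]].
  exists (a *: u + u'), (a *: n + n'); split; last by rewrite linearP.
  + by rewrite memvD ?memvZ.
  + exact: PD.
  by rewrite scalerDr addrACA.
- move=> c [a [n [aA Pn an ->]]].
  have -> : a = 0; last by rewrite linear0.
  apply/eqP; apply: contrapT => /negP a0; apply: nP; exists a; split=> //.
  have -> : a = - n by apply/eqP; rewrite -addr_eq0 -an.
  exact: PN.
exists phi; split=> a Ha; apply: phiP; last by exists 0, a; rewrite add0r linear0 mem0v.
by exists a, 0; rewrite addr0.
Qed.

(** As [phi] kills [N y], the scalar [phi (s x0)] depends on [s y] alone; this defines [gam], and
    [dual_section] applies. *)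
Let dual_of_N (psi : 'Hom(V x0, k^o)) y : le x0 y -> ~ meet (N y) ->
  exists2 g, dcoh (Itv x0 y) (Itv x0 y) g & forall a, a \in A -> g x0 a = psi a.
Proof.
move=> xy nN; have [phi [phiA phiN]] := extend_avoiding psi (lclosedN y) nN.
pose G b (c : k) := exists2 s, coh (Itv x0 y) (Itv x0 y) s &
  b = s y /\ c = phi (s x0).
have [|||gam gamP] := @functional_extend k (V y) G.
- by exists (fun=> 0); [apply: coh0|rewrite linear0].
- move=> a _ _ _ _ [s cs [-> ->]] [t ct [-> ->]].
  by exists (fun x => a *: s x + t x); [apply: cohD|rewrite linearP].
- by move=> c [s cs [sy ->]]; apply: phiN; exists s.
have [|g [cg gx gy]] := dual_section LQ mP xy (phi := phi) (gam := gam).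
  by move=> s cs; apply/esym/gamP; exists s.
by exists g => // a aA; rewrite gx phiA.
Qed.

(** As [phi] kills [E z], [dual_section] joins [phi] to 0 at [z]; beyond [z] the functionals stay
    zero. *)
Let dual_of_E (psi : 'Hom(V x0, k^o)) z : le x0 z -> ~ meet (E z) ->
  exists g, [/\ dcoh (le x0) (le x0) g, forall a, a \in A -> g x0 a = psi a &
    forall w, le z w -> g w = 0].
Proof.
move=> xz nE; have [phi [phiA phiE]] := extend_avoiding psi (lclosedE z) nE.
have [|g [cg gx gz]] := dual_section LQ mP xz (phi := phi) (gam := 0).
  by move=> s cs; rewrite zero_lfunE; apply: phiE; exists s.
have [|||r [rs rt cr]] := coherent_glue (line_quiver_op LQ) (dual_map_comp mP) (y := z)
  _ _ _ gz cg (@coherent0 k T (fun x y => ord y x) _ _ dlin (le z) (le z)).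
- by move=> u; rewrite orbb => /andP[].
- by move=> u; rewrite orbb.
- by rewrite /itv !lexx xz.
exists r; split=> [|a aA|//].
- apply: coherentS cr => u xu; rewrite /= /itv xu;
  by apply: (lq_total LQ).
- by rewrite rs // gx phiA.
Qed.

Let affine_agree (psi : 'Hom(V x0, k^o)) :
  affine (fun phi : 'Hom(V x0, k^o) => forall a, a \in A -> phi a = psi a).
Proof.
move=> c u v w uP vP wP a aA.
by rewrite !(add_lfunE, scale_lfunE, opp_lfunE) uP // vP // wP // subrr scaler0 addr0.
Qed.

Let affine_eq (v : V x0) : affine (fun a => a = v).
Proof. by move=> c _ _ _ -> -> ->; rewrite subrr scaler0 addr0. Qed.

Local Notation initial := (initial_segment le x0).

(** By compactness it suffices to use [dual_of_N] at a point of [D] beyond finitely many given ones.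
    The last hypothesis says that no arrow enters [D] from the rest of the half-line, so the
    functionals can be cut off outside [D]. *)
Let dual_extend D (psi : 'Hom(V x0, k^o)) : initial D -> (forall y, D y -> ~ meet (N y)) ->
  (forall u w, D u -> le x0 w -> ~~ D w -> ~ ord u w) ->
  exists g, [/\ dcoh D (le x0) g, forall a, a \in A -> g x0 a = psi a &
    forall y, ~~ D y -> g y = 0].
Proof.
move=> [Dx Dge Dcl] DN out.
have [Y|g [gA cg _]] := @coherent_extend k T (fun x y => ord y x)
    (fun x => 'Hom(V x, k^o) : vectType k) (dual_map m) dlin x0
    (fun phi => forall a, a \in A -> phi a = psi a) D D predT (@affine_agree psi).
  have [y Dy ymax] := seq_extremum Y lexx (lq_trans LQ) (lq_total LQ) Dx.
  have [g cg gA] := dual_of_N psi (Dge _ Dy) (DN _ Dy).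
  exists g; split=> //; apply: coherentS cg => u /= /andP[uY Du];
  by rewrite /itv Dge //= ymax.
exists (fun x => if D x then g x else 0); split.
- exact: (coherent_cut cg).
- by rewrite Dx.
by move=> y /negPf->.
Qed.

(* If some [N y] meets [A], a vector of the smallest such intersection dies at
   the end of [D]; otherwise a vector of the smallest nonzero intersection of
   [A] with an [E y] cannot be extended past [D]. *)
Lemma one_side : A != 0%VS -> exists D : pred T,
  [/\ initial D,
    exists f, [/\ f x0 \in A, f x0 != 0, coh D (le x0) f &
      forall y, le x0 y -> ~~ D y -> f y = 0] &
    forall psi : 'Hom(V x0, k^o), exists g, [/\ dcoh D (le x0) g,
      forall a, a \in A -> g x0 a = psi a &
      forall y, le x0 y -> ~~ D y -> g y = 0]].
Proof.
move=> A0; have [[y1 [xy1 Ny1]]|noN] := pselect (exists y, le x0 y /\ meet (N y)).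
  pose D y := le x0 y && ~~ `[< meet (N y) >].
  have iD : initial D.
    split=> [|y /andP[]//|y z xy yz /andP[xz /asboolPn nz]].
      rewrite /D lexx; apply/asboolPn => -[a [_ /eqP a0 [s [_ sa s0]]]].
      by apply: a0; rewrite -sa.
    rewrite /D xy; apply/asboolPn => ny; apply: nz.
    by apply: meetS ny => a; apply: N_mono.
  have [Dx Dge Dcl] := iD.
  pose K y := le x0 y && ~~ D y.
  have KN y : K y -> meet (N y).
    by rewrite /K /D => /andP[-> /= /negPn/asboolP].
  have K1 : K y1 by rewrite /K /D xy1 /= negbK; apply/asboolP.
  exists D; split=> //; last first.
    move=> psi.
    have [y|u w Du xw nDw|g [cg gA g0]] := @dual_extend D psi iD.
    - by move=> /andP[_ /asboolPn].
    (* An arrow from [w] to [u] carries the zero at [w] to [u], so [N u] would meet [A]. *)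
    - move=> ouw; have [uw|wu] := orP (lq_total LQ u w); last first.
        by case/negP: nDw; apply: Dcl Du.
      have /andP[xu /asboolPn nu] := Du; apply: nu.
      have /KN : K w by rewrite /K xw.
      apply: meetS => a [s [cs sx sw]]; exists s; split=> //.
        by apply: coherentS cs; apply: sub_itv.
      by rewrite -(cs w u) ?sw ?linear0 // /itv ?xw ?lexx ?xu ?uw.
    by exists g; split=> // y _; apply: g0.
  have [|y z yz Ky Kz|v [vA v0 vN]] := meet_min K1 lclosedN _ _.
  - exact: KN.
  - by left=> a; apply: N_mono => //; case/andP: Ky.
  have [Y|f [fv cf f0]] := @coherent_extend k T ord V (fun x y => m x y) mlin x0
      (fun a => a = v) (le x0) (le x0) (fun y => ~~ le x0 y || D y) (@affine_eq v).
    (* The reversed order gives a point outside [D] at or before all those in [Y]; a section from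
       [v] that vanishes from there on serves all of [Y]. *)
    have [z Kz zmin] := seq_extremum Y (lq_refl (line_quiver_flip LQ))
      (lq_trans (line_quiver_flip LQ)) (lq_total (line_quiver_flip LQ)) K1.
    have xz : le x0 z by case/andP: Kz.
    have [s [cs sx s0]] := N_global xz (vN _ Kz).
    exists s; split=> //; first by apply: coherentS cs => u /andP[].
    by move=> w wY; rewrite negb_or negbK => Kw; apply/s0/zmin.
  exists f; rewrite fv; split=> //.
  - by apply: coherentS cf => // u /Dge.
  - by move=> y xy nDy; apply: f0; rewrite xy.
pose D y := le x0 y && `[< meet (E y) >].
have iD : initial D.
  split=> [|y /andP[]//|y z xy yz /andP[xz /asboolP Ez]].
    rewrite /D lexx; apply/asboolP.
    exists (vpick A); rewrite memv_pick vpick0 A0; split=> //.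
    exists (fun u => m x0 u (vpick A)); last exact: mid.
    have Ix u : Itv x0 x0 u -> u = x0.
      by move=> /andP[xu ux]; apply: (lq_anti LQ); rewrite xu ux.
    by move=> u w /Ix-> /Ix-> _; rewrite !mid.
  rewrite /D xy; apply/asboolP.
  by apply: meetS Ez => a; apply: E_mono.
have [Dx Dge Dcl] := iD.
(* A section over the interval from [x0] to [u] would extend along an arrow from [u] to [w], so
   [E w] would meet [A]. *)
have out u w : D u -> le x0 w -> ~~ D w -> ~ ord w u.
  move=> Du xw nDw owu; have [uw|wu] := orP (lq_total LQ u w); last first.
    by case/negP: nDw; apply: Dcl Du.
  case/negP: nDw; rewrite /D xw; apply/asboolP.
  have /andP[xu /asboolP] := Du; apply: meetS => a [s cs sx].
  have [||||||r [rs rt cr]] := coherent_glue LQ mcomp (y := u)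
      (D1 := Itv x0 u) (E1 := Itv x0 u) (D2 := Itv u w) (E2 := Itv u w)
      (s := s) (t := fun z => m u z (s u)).
  - by move=> z; rewrite orbb => /andP[].
  - by move=> z; rewrite orbb => /andP[].
  - by rewrite /itv !lexx xu uw.
  - by rewrite mid.
  - exact: cs.
  - move=> c d /andP[uc cw] /andP[ud dw] odc; rewrite mcomp //.
    by have [] := lq_up LQ uc cw owu.
  exists r; last by rewrite rs.
  apply: coherentS cr => z /andP[xz zw]; rewrite /= /itv xz zw;
  by rewrite andbT /=; apply: (lq_total LQ).
exists D; split=> //.
  have [|y z yz Ky Kz|v [vA v0 vE]] := meet_min Dx lclosedE _ _.
  - by move=> y /andP[_ /asboolP].
  - by right=> a; apply: E_mono.
  have [Y|f [fv cf _]] := @coherent_extend k T ord V (fun x y => m x y) mlin x0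
      (fun a => a = v) D D predT (@affine_eq v).
    have [y Dy ymax] := seq_extremum Y lexx (lq_trans LQ) (lq_total LQ) Dx.
    have [s cs sx] := vE _ Dy.
    exists s; split=> //; apply: coherentS cs => u /= /andP[uY Du];
    by rewrite /itv Dge //= ymax.
  exists (fun x => if D x then f x else 0); rewrite Dx fv; split=> //.
    exact: (coherent_cut cf).
  by move=> y _ /negPf->.
move=> psi; pose K y := le x0 y && ~~ D y.
(* If [D] ends, the functionals come from [dual_of_E] at points outside [D]; if [D] is the whole
   half-line, they come from [dual_extend], as no [N y] meets [A]. *)
have [[z0 K0]|noK] := pselect (exists z, K z).
  have [Y|g [gA cg g0]] := @coherent_extend k T (fun x y => ord y x)
      (fun x => 'Hom(V x, k^o) : vectType k) (dual_map m) dlin x0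
      (fun phi => forall a, a \in A -> phi a = psi a) (le x0) (le x0)
      (fun y => ~~ le x0 y || D y) (@affine_agree psi).
    have [z /andP[xz nDz] zmin] := seq_extremum Y (lq_refl (line_quiver_flip LQ))
      (lq_trans (line_quiver_flip LQ)) (lq_total (line_quiver_flip LQ)) K0.
    have nE : ~ meet (E z) by move: nDz; rewrite /D xz => /asboolPn.
    have [g [cg gA g0]] := dual_of_E psi xz nE.
    exists g; split=> //; first by apply: coherentS cg => u /andP[].
    by move=> w wY; rewrite negb_or negbK => Kw; apply/g0/zmin.
  exists g; split=> //.
  - by apply: coherentS cg => // u /Dge.
  - by move=> y xy nDy; apply: g0; rewrite xy.
have [|u w Du xw nDw|g [cg gA g0]] := @dual_extend D psi iD.
- by move=> y /Dge xy Ny; apply: noN; exists y.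
- by case: noK; exists w; rewrite /K xw.
by exists g; split=> // y _; apply: g0.
Qed.

End OneSide.

(** * Interval summands: existence and local finiteness *)

Section Summand.
Variables (k : fieldType) (T : eqType) (le : rel T) (ord : T -> T -> Prop).

(* Morphisms [f : M_I -> V] and [g : V -> M_I] with [g f = 1]. *)
Record summand (V : T -> vectType k) (m : forall x y, 'Hom(V x, V y)) :=
    Summand {
  sm_I : pred T;
  sm_f : forall x, V x;
  sm_g : forall x, 'Hom(V x, k^o);
  sm_convex : forall x y z, le x y -> le y z -> sm_I x -> sm_I z -> sm_I y;
  sm_nonempty : exists x, sm_I x;
  sm_fcoh : coh ord m sm_I predT sm_f;
  sm_gcoh : dcoh ord m sm_I predT sm_g;
  sm_f0 : forall x, ~~ sm_I x -> sm_f x = 0;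
  sm_g0 : forall x, ~~ sm_I x -> sm_g x = 0;
  sm_gf : forall x, sm_I x -> sm_g x (sm_f x) = 1
}.

Variables (V : T -> vectType k) (m : forall x y, 'Hom(V x, V y)).
Hypothesis LQ : line_quiver le ord.
Hypothesis mP : linerep_axiom ord m.

Lemma summand_exists x0 (v0 : V x0) : v0 != 0 -> exists a : summand m, sm_I a x0.
Proof.
move=> v00; have LQ' := line_quiver_flip LQ.
have full0 : fullv != 0%VS :> {vspace V x0}.
  by apply: contraNneq v00 => f0; rewrite -memv0 -f0 memvf.
have [D [[Dx Dge Dcl] [f0 [_ f00 cf0 f0D]] gD]] := one_side LQ mP full0.
pose ext v := exists f, [/\ f x0 = v, coh ord m D (le x0) f &
  forall y, le x0 y -> ~~ D y -> f y = 0].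
have [A AP] : exists A : {vspace V x0}, forall v, v \in A <-> ext v.
  apply: vspace_of_lclosed; split.
    by exists (fun=> 0); split=> //; apply: coh0.
  move=> a u v [f [fu cf f0']] [g [gv cg g0]].
  exists (fun x => a *: f x + g x); split; first by rewrite fu gv.
    exact: cohD.
  by move=> y xy nD; rewrite f0' // g0 // scaler0 addr0.
have A0 : A != 0%VS.
  apply: contraNneq f00 => A0; rewrite -memv0 -A0; apply/AP.
  by exists f0.
have [D' [[D'x D'le D'cl] [f' [f'A f'0 cf' f'D]] gD']] := one_side LQ' mP A0.
have /AP[f1 [f1x cf1 f1D]] := f'A.
have [psi psif] : exists psi : 'Hom(V x0, k^o), psi (f' x0) = 1.
  pose G v (c : k) := exists2 a, v = a *: f' x0 & c = a.
  have [|||psi psiP] := @functional_extend k (V x0) G.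
  - by exists 0; rewrite ?scale0r.
  - move=> a _ _ _ _ [b -> ->] [c -> ->].
    by exists (a * b + c); rewrite // scalerDl scalerA.
  - by move=> c [a /esym/eqP + ->]; rewrite scaler_eq0 (negPf f'0) orbF => /eqP.
  by exists psi; apply: psiP; exists 1; rewrite ?scale1r.
(* The order of the choices matters: [g'] agrees with [psi] on [A] only, which suffices because
   [f' x0] lies in [A]. Then [g1] can start exactly at [g' x0], since on the right functionals are
   prescribed on the full space. *)
have [g' [cg' g'A g'D]] := gD' psi.
have [g1 [cg1 g1A g1D]] := gD (g' x0).
have g1x : g1 x0 = g' x0 by apply/lfunP => v; apply: g1A; rewrite memvf.
pose I := predU D' D.
have Iconv x y z : le x y -> le y z -> I x -> I z -> I y.
  have tot := lq_total LQ; have tr := lq_trans LQ.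
  move=> xy yz /= Ix Iz; apply/orP.
  have [x0y|yx0] := orP (tot x0 y).
    right; case/orP: Iz => [/D'le zx0|Dz]; last exact: Dcl Dz.
    have -> // : y = x0.
    by apply: (lq_anti LQ); rewrite x0y (tr _ _ _ yz zx0).
  left; case/orP: Ix => [D'x'|/Dge x0x]; first exact: D'cl D'x'.
  have -> // : y = x0.
  by apply: (lq_anti LQ); rewrite yx0 (tr _ _ _ x0x xy).
have lexx := lq_refl LQ.
have [|||f [fl fr cf]] := coherent_glue LQ mP.2 (y := x0) _ _ _ (esym f1x) cf' cf1.
- by move=> u /orP[/D'le|].
- by move=> u /orP[/Dge|].
- by rewrite D'x Dx lexx.
have [|||g [gl gr cg]] :=
  coherent_glue (line_quiver_op LQ) (dual_map_comp mP) (y := x0)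
    _ _ _ (esym g1x) cg' cg1.
- by move=> u /orP[/D'le|].
- by move=> u /orP[/Dge|].
- by rewrite D'x Dx lexx.
have Efull : subpred predT (predU (fun y => le y x0) (le x0)).
  by move=> y _; apply: (lq_total LQ).
have fcoh : coh ord m I predT f by apply: coherentS cf.
have gcoh : dcoh ord m I predT g by apply: coherentS cg.
have f_0 x : ~~ I x -> f x = 0.
  rewrite negb_or => /andP[nD' nD].
  by have [xx|xx] := orP (lq_total LQ x x0); [rewrite fl ?f'D|rewrite fr ?f1D].
have g_0 x : ~~ I x -> g x = 0.
  rewrite negb_or => /andP[nD' nD].
  by have [xx|xx] := orP (lq_total LQ x x0); [rewrite gl ?g'D|rewrite gr ?g1D].
(* Both [f] and [g] respect arrows inside [I], so the pairing is constant along an arrow, and by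
   [lq_ind] on all of [I]. *)
have gfE x y : le x y -> I x -> I y -> g x (f x) = g y (f y).
  elim/(lq_ind LQ): x y / => [x y xy [yx|yx] Ix Iy|x y z xy yz IH1 IH2 Ix Iz].
  - have /dcohP gc := gcoh; rewrite (gc x y) //; congr (g x _).
    by apply/esym; apply: fcoh.
  - have /dcohP gc := gcoh; rewrite (gc y x) //; congr (g y _).
    exact: fcoh.
  - by have Iy := Iconv _ _ _ xy yz Ix Iz; rewrite IH1 // IH2.
have gf0 : g x0 (f x0) = 1 by rewrite gl // fl // g'A // psif.
have Ix0 : I x0 by rewrite /= Dx orbT.
have gf x : I x -> g x (f x) = 1.
  by move=> Ix; have [xx|xx] := orP (lq_total LQ x x0); [rewrite (gfE _ x0)|rewrite -(gfE x0)].
by exists (Summand Iconv (ex_intro _ x0 Ix0) fcoh gcoh f_0 g_0 gf).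
Qed.

Section Family.
Variables (J : eqType) (a : J -> summand m).
Hypothesis orth : forall i j, i != j -> forall x, sm_g (a i) x (sm_f (a j) x) = 0.

(** Applying the [sm_g (a i) x] shows that the vectors [sm_f (a j) x] of the summands alive at [x]
    are independent. The dimension bounds their number, and a longest list contains them all. *)
Lemma summands_at x : exists l : seq J, uniq l /\ forall j, (j \in l) = sm_I (a j) x.
Proof.
pose Q n := `[< exists l, [/\ uniq l, size l = n & forall j, j \in l -> sm_I (a j) x] >].
have Q0 : exists n, Q n by exists 0%N; apply/asboolP; exists [::].
have Qle n : Q n -> (n <= \dim {:V x})%N.
  move=> /asboolP[l [lu <- lI]].
  pose X := map_tuple (fun j => sm_f (a j) x) (in_tuple l).
  have frX : free X.
    apply/freeP => c c0 i.
    have j0 : J by case: l lu lI X c c0 i => [|j l] // _ _ _ _ _ [].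
    have := congr1 (sm_g (a (nth j0 l i)) x) c0.
    rewrite linear_sum linear0 (bigD1 i) //= big1 ?addr0 => [|i' ii'].
      rewrite linearZ /= (nth_map j0) // sm_gf ?lI ?mem_nth //.
      by rewrite [_ *: _]mulr1.
    rewrite linearZ /= (nth_map j0) // orth ?scaler0 //.
    by rewrite nth_uniq // eq_sym.
  by rewrite -(size_tuple X) -(eqP frX) dimvS ?subvf.
case: (ex_maxnP Q0 Qle) => n /asboolP[l [lu ln lI]] nmax.
exists l; split=> // j; apply/idP/idP => [/lI//|Ij].
apply: contraT => jl.
have /nmax : Q n.+1; last by rewrite ltnn.
apply/asboolP; exists (j :: l); split; rewrite /= ?jl ?lu ?ln //.
by move=> i /[1!inE] /orP[/eqP->|/lI].
Qed.

End Family.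
End Summand.

Arguments sm_fcoh {k T le ord V m} s.
Arguments sm_gcoh {k T le ord V m} s.

(** * Splitting off a maximal orthogonal family of summands *)

Section Decomposition.
Variables (k : fieldType) (T : eqType) (le : rel T) (ord : T -> T -> Prop).
Variables (V : T -> vectType k) (m : forall x y, 'Hom(V x, V y)).
Hypothesis LQ : line_quiver le ord.
Hypothesis mP : linerep_axiom ord m.

Local Notation summand := (summand le ord m).

(* The vectors killed by all [sm_g (a j)] form a subrepresentation, onto which V
   retracts; a summand of it is a summand of V. *)
Lemma residual_summand (J : eqType) (a : J -> summand) :
  (forall i j, i != j -> forall x, sm_g (a i) x (sm_f (a j) x) = 0) ->
  forall x0 v0, v0 != 0 -> (forall j, sm_g (a j) x0 v0 = 0) ->
  exists b : summand, forall j x,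
    sm_g (a j) x (sm_f b x) = 0 /\ sm_g b x (sm_f (a j) x) = 0.
Proof.
move=> orth x0 v0 v00 gv0.
have [U UP] : exists U : forall x, {vspace V x},
    forall x v, v \in U x <-> forall j, sm_g (a j) x v = 0.
  have exU x : exists U : {vspace V x},
      forall v, v \in U <-> forall j, sm_g (a j) x v = 0.
    apply: vspace_of_lclosed; split=> [j|c u v u0 w0 j]; first by rewrite linear0.
    by rewrite linearP /= u0 w0 scaler0 addr0.
  by exists (fun x => sval (cid (exU x))) => x; apply: svalP (cid (exU x)).
have /choice[l lP] x := summands_at orth x.
(* The projection onto [U x] along the given summands. *)
pose p x (v : V x) := v - \sum_(j <- l x) sm_g (a j) x v *: sm_f (a j) x.
have plin x : linear (@p x).
  move=> c u v; rewrite /p scalerBr addrACA -opprD; congr (_ - _).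
  rewrite scaler_sumr -big_split; apply: eq_bigr => j _ /=.
  by rewrite linearP scalerDl scalerA.
have pU x v : @p x v \in U x.
  apply/UP => i; rewrite /p linearB linear_sum /=.
  have [Ii|nIi] := boolP (sm_I (a i) x); last first.
    by rewrite (sm_g0 nIi) zero_lfunE big1 ?subrr // => j _; rewrite zero_lfunE.
  rewrite (bigD1_seq i) ?(lP x).1 ?(lP x).2 //= big1_seq ?addr0 => [|j /andP[ji _]].
    by rewrite linearZ /= sm_gf // [_ *: _]mulr1 subrr.
  by rewrite linearZ /= orth ?scaler0 // eq_sym.
have pid x v : v \in U x -> @p x v = v.
  by move=> /UP g0; rewrite /p big1 ?subr0 // => j _; rewrite g0 scale0r.
have gm j y z v : ord z y -> sm_I (a j) z -> sm_g (a j) z (m y z v) = sm_g (a j) y v.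
  by move=> zy Iz; have /dcohP gc := sm_gcoh (a j); rewrite (gc z y).
have fm j y z : ord z y -> sm_I (a j) y -> m y z (sm_f (a j) y) = sm_f (a j) z.
  by move=> zy Iy; apply: (sm_fcoh (a j)).
have pnat y z v : ord z y -> m y z (p y v) = p z (m y z v).
  move=> zy; rewrite /p linearB linear_sum; congr (_ - _).
  (* Only summands alive at both points contribute to either side: otherwise [sm_f (a j) z] or
     [sm_g (a j) y] vanishes. *)
  transitivity (\sum_(j <- l y | sm_I (a j) z) sm_g (a j) y v *: sm_f (a j) z).
    rewrite [RHS]big_mkcond; apply: eq_big_seq => j; rewrite (lP y).2 => Iy.
    by rewrite linearZ /= fm //; case: ifPn => // nI; rewrite sm_f0 ?scaler0.
  transitivity (\sum_(j <- l z | sm_I (a j) y) sm_g (a j) y v *: sm_f (a j) z).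
    rewrite -big_filter -[RHS]big_filter; apply/perm_big/uniq_perm.
    - exact/filter_uniq/(lP y).1.
    - exact/filter_uniq/(lP z).1.
    - by move=> j; rewrite !mem_filter (lP y).2 (lP z).2 andbC.
  rewrite [LHS]big_mkcond; apply: eq_big_seq => j; rewrite (lP z).2 => Iz.
  rewrite gm //; case: ifPn => // nI.
  by rewrite (@sm_g0 _ _ _ _ _ _ (a j)) ?zero_lfunE ?scale0r.
have mU y z v : ord z y -> v \in U y -> m y z v \in U z.
  by move=> zy vU; rewrite -(pid _ _ vU) pnat // pU.
pose W x : vectType k := subvs_of (U x).
pose mW x y : 'Hom(W x, W y) :=
  (linfun (vsproj (U y)) \o m x y \o linfun (vsval : subvs_of (U x) -> V x))%VF.
have mWE x y (w : W x) : ord y x -> vsval (mW x y w) = m x y (vsval w).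
  move=> yx; rewrite !lfunE /= !lfunE /= !lfunE /= vsprojK //.
  exact/mU/subvsP.
have WP : linerep_axiom ord mW.
  split=> [x v|x y z yx zy v]; apply: val_inj.
    by rewrite /= mWE ?mP.1 //; apply: (lq_ordxx LQ).
  by rewrite /= !mWE ?mP.2 //; apply: (lq_ord_trans LQ) yx.
have w00 : vsproj (U x0) v0 != 0.
  apply: contra v00 => /eqP w0.
  by rewrite -(vsprojK (U := U x0) (x := v0)) ?w0 //; apply/UP.
have [b bx0] := summand_exists LQ WP w00.
(* Composition with [p] extends the functional from [U x] to [V x] and makes it kill the old
   summands. *)
pose gf x (v : V x) : k^o := sm_g b x (vsproj (U x) (p x v)).
have glin x : linear (gf x) by move=> c u v; rewrite /gf plin !linearP.
pose g x : 'Hom(V x, k^o) := sval (cid (hom_of_linear (glin x))).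
have gE x v : g x v = sm_g b x (vsproj (U x) (p x v)).
  exact: (svalP (cid (hom_of_linear (glin x)))).
pose f x := vsval (sm_f b x).
have fU x : f x \in U x by apply: subvsP.
have fcoh : coh ord m (sm_I b) predT f.
  by move=> u w Iu _ wu; rewrite -mWE // (sm_fcoh b).
have gcoh : dcoh ord m (sm_I b) predT g.
  apply/dcohP => u w Iu _ uw v; have /dcohP gc := sm_gcoh b.
  rewrite !gE (gc u w) //; congr (sm_g b u _); apply: val_inj.
  by rewrite /= mWE // !vsprojK ?pU // pnat.
have f0 x : ~~ sm_I b x -> f x = 0 by move=> nI; rewrite /f sm_f0.
have g0 x : ~~ sm_I b x -> g x = 0.
  by move=> nI; apply/lfunP => v; rewrite gE (sm_g0 nI) !zero_lfunE.
have gf1 x : sm_I b x -> g x (f x) = 1.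
  by move=> Ix; rewrite gE pid // /f vsvalK sm_gf.
exists (Summand (@sm_convex _ _ _ _ _ _ b) (sm_nonempty b) fcoh gcoh f0 g0 gf1).
move=> j x; split; first exact: (UP x _).1.
rewrite /= gE; suff -> : p x (sm_f (a j) x) = 0 by rewrite !linear0.
have [Ij|nIj] := boolP (sm_I (a j) x); last first.
  by rewrite sm_f0 // pid ?mem0v.
rewrite /p (bigD1_seq j) ?(lP x).1 ?(lP x).2 //= sm_gf // scale1r.
rewrite big1_seq ?addr0 ?subrr // => i /andP[ij _].
by rewrite orth // scale0r.
Qed.

Lemma summand_decomposition : exists (J : eqType) (a : J -> summand),
  (forall i j, i != j -> forall x, sm_g (a i) x (sm_f (a j) x) = 0) /\
  forall x v, (forall j, sm_g (a j) x v = 0) -> v = 0.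
Proof.
pose good (F : set summand) := forall a b, F a -> F b -> a <> b ->
  forall x, sm_g a x (sm_f b x) = 0.
have [F subF totF a b [A FA Aa] [B FB Bb]|F [gF Fmax]] := @Zorn_bigcup _ good.
  have [AB|BA] := totF _ _ FA FB; first exact: (subF _ FB) (AB _ Aa) Bb.
  exact: (subF _ FA) Aa (BA _ Bb).
have orth (i j : {classic {a | F a}}) : i != j ->
    forall x, sm_g (sval i) x (sm_f (sval j) x) = 0.
  move=> ij; apply: gF; [exact: (svalP i)|exact: (svalP j)|].
  case: i j ij => [a Fa] [b Fb] /= /eqP ab eab; apply: ab.
  by case: _ / eab Fb => Fb; congr exist; apply: Prop_irrelevance.
exists {classic {a | F a}}, (fun j => sval j); split=> // x v gv.
apply/eqP; apply: contrapT => /negP v0.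
have [b bP] := residual_summand orth v0 gv.
(* A member of [F] would be orthogonal to itself, against [sm_gf]. *)
have nFb : ~ F b.
  move=> Fb; have [y Iy] := sm_nonempty b.
  have /eqP := (bP (exist _ b Fb) y).1.
  by rewrite /= sm_gf // oner_eq0.
apply: (Fmax (F `|` [set b])).
  by split=> [a Fa|sub]; [left|apply/nFb/sub; right].
move=> a c [Fa|->] [Fc|->] ac y.
- exact: gF.
- exact: (bP (exist _ a Fa) y).1.
- exact: (bP (exist _ c Fc) y).2.
- by [].
Qed.

End Decomposition.

(** * The orientation of the real line *)

Section QuiverLine.
Variables (R : realType) (Q : ctA_quiver R).

Local Notation S := (quiv_S Q).
Local Notation s := (quiv_s Q).
Local Notation idx := (quiv_idx Q).

Let isolated (x : R) : exists2 e : R, 0 < e &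
  forall y, S y -> y != x -> e <= `|x - y|.
Proof.
apply: contrapT => noe.
suff : limit_point S x by rewrite quiv_S_noacc.
move=> U /nbhs_ballP[e /= e0 eU]; apply: contrapT => noy; apply: noe.
exists e => // y Sy yx; rewrite leNgt; apply/negP => xy; apply: noy.
by exists y; split=> //; apply: eU.
Qed.

(** By [isolated], a point of [S] close enough to the supremum is equal to it. *)
Let sup_mem (A : set R) : A `<=` S -> has_sup A -> A (sup A).
Proof.
move=> AS supA; have [e e0 eP] := isolated (sup A).
have [y Ay ltey] := sup_adherent e0 supA.
have [<-//|yx] := eqVneq y (sup A).
have := eP _ (AS _ Ay) yx.
have yA : y <= sup A by apply: ub_le_sup => //; exact: supA.2.
by rewrite ger0_norm ?subr_ge0 // => ?; lra.
Qed.

Let inf_mem (A : set R) : A `<=` S -> has_inf A -> A (inf A).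
Proof.
move=> AS infA; have [e e0 eP] := isolated (inf A).
have [y Ay ltey] := inf_adherent e0 infA.
have [<-//|yx] := eqVneq y (inf A).
have := eP _ (AS _ Ay) yx.
have yA : inf A <= y by apply: ge_inf => //; exact: infA.2.
by rewrite ler0_norm ?subr_le0 // => ?; lra.
Qed.

Let idx_of (z : \bar R) : (EFin @` S `|` [set -oo; +oo]%E) z ->
  exists2 p, idx p & s p = z.
Proof. by rewrite -quiv_s_image => -[p]; exists p. Qed.

Let s_of p : idx p -> [\/ exists2 t, S t & s p = t%:E, s p = -oo%E | s p = +oo%E].
Proof.
move=> ip; have : (s @` idx) (s p) by exists p.
by rewrite quiv_s_image => -[[t St <-]|[->|->]];
  [apply: Or31; exists t|apply: Or32|apply: Or33].
Qed.

Let max_below (x : R) : exists p, [/\ idx p, (s p <= x%:E)%E &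
  forall q, idx q -> (s q <= x%:E)%E -> (s q <= s p)%E].
Proof.
pose A := [set t | S t /\ t <= x].
have [A0|/set0P An0] := eqVneq A set0.
  have [|p ip sp] := idx_of (z := -oo%E); first by right; left.
  exists p; rewrite sp leNye; split=> // q /s_of[[t St ->]|->|->] //.
  by rewrite lee_fin => tx; suff : A t by rewrite A0.
have ubA : ubound A x by move=> t [].
have supA : has_sup A by split=> //; exists x.
have [SA Ax] : A (sup A) by apply: sup_mem => // t [].
have [|p ip sp] := idx_of (z := (sup A)%:E); first by left; exists (sup A).
exists p; rewrite sp; split=> // q /s_of[[t St ->]|->|->]; rewrite ?leNye //.
by rewrite !lee_fin => tx; apply: ub_le_sup; [exists x|].
Qed.

Let min_above (x : R) : exists p, [/\ idx p, (x%:E < s p)%E &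
  forall q, idx q -> (x%:E < s q)%E -> (s p <= s q)%E].
Proof.
pose A := [set t | S t /\ x < t].
have [A0|/set0P An0] := eqVneq A set0.
  have [|p ip sp] := idx_of (z := +oo%E); first by right; right.
  exists p; rewrite sp ltry; split=> // q /s_of[[t St ->]|->|->] //.
  by rewrite lte_fin => tx; suff : A t by rewrite A0.
have lbA : lbound A x by move=> t [_ /ltW].
have infA : has_inf A by split=> //; exists x.
have [SA Ax] : A (inf A) by apply: inf_mem => // t [].
have [|p ip sp] := idx_of (z := (inf A)%:E); first by left; exists (inf A).
exists p; rewrite sp lte_fin; split=> // q /s_of[[t St ->]|->|->] //.
  by rewrite lte_fin lee_fin => tx; apply: ge_inf; [exists x|].
by rewrite leey.
Qed.

(** By convexity no index lies strictly between those of the two neighbours of [x]; an infinite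
    index would leave room for [p + 1], [q - 1] or 0. The strict upper bound makes the pieces
    disjoint. *)
Lemma piece_exists (x : R) : exists n : int, [/\ idx n%:E, idx (n + 1)%:E,
  (s n%:E <= x%:E)%E & (x%:E < s (n + 1)%:E)%E].
Proof.
have [p [ip px pmax]] := max_below x; have [q [iq xq qmin]] := min_above x.
have ltpq : (p < q)%E.
  by rewrite ltNge -(quiv_s_mono iq ip) -ltNge (le_lt_trans px).
have gap r : (p < r)%E -> (r < q)%E -> False.
  move=> pr rq; have ir := quiv_idx_convex ip iq (ltW pr) (ltW rq).
  have [rx|xr] := leP (s r) x%:E.
    by have := pmax _ ir rx; rewrite (quiv_s_mono ir ip) leNgt pr.
  by have := qmin _ ir xr; rewrite (quiv_s_mono iq ir) leNgt rq.
case: p q ip iq px xq {pmax qmin} ltpq gap => [p||] [q||] //.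
- move=> ip iq px xq ltpq gap; exists p; suff -> : p + 1 = q by [].
  apply/eqP; rewrite eq_le lezD1 -lte_fin ltpq /= leNgt; apply/negP => lt1.
  by apply: (gap (p + 1)%:E); rewrite lte_fin // ltzD1.
- by move=> _ _ _ _ _ /(_ (p + 1)%:E); rewrite lte_fin ltzD1 lexx ltry => /(_ isT isT).
- by move=> _ _ _ _ _ /(_ (q - 1)%:E); rewrite lte_fin ltrBlDr ltzD1 lexx ltNyr => /(_ isT isT).
- by move=> _ _ _ _ _ /(_ 0%E); rewrite ltNyr ltry => /(_ isT isT).
Qed.

Let piece_comparable (n : int) (x y : R) : idx n%:E -> idx (n + 1)%:E ->
  in_piece Q n x -> in_piece Q n y -> x <= y -> qle Q x y \/ qle Q y x.
Proof.
move=> i0 i1 nx ny xy; have [pn|pn] := boolP (2 %| n)%Z; [left|right];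
by right; exists n; rewrite ?pn ?(negPf pn).
Qed.

Let in_piece_mid (n : int) (x y z : R) : x <= y -> y <= z ->
  in_piece Q n x -> in_piece Q n z -> in_piece Q n y.
Proof.
move=> xy yz /andP[nx _] /andP[_ zn].
by rewrite /in_piece (le_trans nx) ?lee_fin // (le_trans _ zn) ?lee_fin.
Qed.

Lemma quiver_line : line_quiver (fun x y : R => x <= y) (qle Q).
Proof.
have /choice[N NP] := piece_exists.
have N_le x y : x <= y -> (N x <= N y)%R.
  move=> xy; have [ix _ Nx _] := NP x; have [_ iy _ Ny] := NP y.
  rewrite -ltzD1 -lte_fin ltNge -(quiv_s_mono iy ix) -ltNge.
  by rewrite (le_lt_trans Nx) // (le_lt_trans _ Ny) // lee_fin.
split.
- exact: lexx.
- exact: le_trans.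
- exact: le_anti.
- exact: le_total.
- exact: qle_refl.
- exact: qle_trans.
- move=> x y z xy yz [xz|[n [i0 i1 nx nz]]].
    have -> : y = x by apply/eqP; rewrite eq_le xy xz yz.
    by rewrite -xz; split; apply: qle_refl.
  (* Within a piece, the parity either gives both relations or reverses the order, and then the
     three points coincide. *)
  have ny := in_piece_mid xy yz nx nz; case: ifP => pn xz.
    by split; right; exists n; rewrite pn.
  have [-> ->] : y = x /\ z = x.
    by split; apply/eqP; rewrite eq_le ?xz ?xy ?(le_trans yz) ?(le_trans xy).
  by split; apply: qle_refl.
- move=> x y z xy yz [zx|[n [i0 i1 nz nx]]].
    have -> : y = z by apply/eqP; rewrite eq_le yz zx xy.
    by rewrite zx; split; apply: qle_refl.
  have ny := in_piece_mid xy yz nx nz; case: ifP => pn zx; last first.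
    by split; right; exists n; rewrite pn.
  have [-> ->] : y = x /\ z = x.
    by split; apply/eqP; rewrite eq_le ?zx ?xy ?(le_trans yz) ?(le_trans xy).
  by split; apply: qle_refl.
move=> P P1 P2.
(* Induction on a bound for the difference of piece indices; points of one piece are comparable. *)
suff main (d : nat) x y : x <= y -> N y - N x <= d%:Z -> P x y.
  by move=> x y xy; apply: (main `|N y - N x|%N); rewrite // lez_abs.
elim: d x y => [|d IH] x y xy Nxy; have [ix ix1 Nx xN] := NP x;
  have [iy iy1 Ny yN] := NP y; have Nle := N_le _ _ xy.
  have NE : N x = N y by apply/eqP; rewrite eq_le Nle -subr_le0.
  apply: P1 => //; apply: (piece_comparable ix ix1) => //.
    by rewrite /in_piece Nx ltW.
  by rewrite NE /in_piece Ny ltW.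
have [NE|Nlt] := eqVneq (N x) (N y).
  apply: P1 => //; apply: (piece_comparable ix ix1) => //.
    by rewrite /in_piece Nx ltW.
  by rewrite NE /in_piece Ny ltW.
have {Nle}Nlt : N x < N y by rewrite lt_neqAle Nlt.
have sy : (s (N x + 1)%:E <= y%:E)%E.
  by rewrite (le_trans _ Ny) // (quiv_s_mono ix1 iy) lee_fin lezD1.
(* The right end of the piece of [x] lies between [x] and [y], hence is finite. It belongs to a
   later half-open piece, so splitting there lowers the difference. *)
have [t st] : exists t, s (N x + 1)%:E = t%:E.
  by case: (s _) xN sy => // t; exists t.
rewrite st in xN sy; rewrite lte_fin in xN; rewrite lee_fin in sy.
apply: (P2 _ t); rewrite ?(ltW xN) //.
  apply: P1; rewrite ?(ltW xN) //; apply: (piece_comparable ix ix1).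
  - by rewrite /in_piece Nx st lee_fin ltW.
  - by rewrite /in_piece st lexx andbT (le_trans Nx) // lee_fin ltW.
  - exact: ltW.
apply: IH => //; have [it it1 Nt tN] := NP t.
have : N x < N t.
  have : ((N x + 1)%:E < (N t + 1)%:E)%E.
    by rewrite ltNge -(quiv_s_mono it1 ix1) -ltNge st.
  by rewrite lte_fin; lia.
by lia.
Qed.

End QuiverLine.

(** * Return to the quiver: coordinates in interval modules and the isomorphism *)

Section BoolSpace.
Variable k : fieldType.

Definition bool_in (b : bool) (c : k) : bool_sp k b :=
  match b return bool_sp k b with true => c | false => 0 end.

Definition bool_out (b : bool) : bool_sp k b -> k :=
  match b return bool_sp k b -> k with true => id | false => fun=> 0 end.

Lemma bool_in_linear b a c d :
  bool_in b (a * c + d) = a *: bool_in b c + bool_in b d.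
Proof. by case: b => //=; rewrite scaler0 addr0. Qed.

Lemma bool_out_linear b a (u v : bool_sp k b) :
  bool_out (a *: u + v) = a * bool_out u + bool_out v.
Proof. by case: b u v => //= *; rewrite mulr0 addr0. Qed.

Lemma bool_in_false (b : bool) c : ~~ b -> bool_in b c = 0.
Proof. by case: b. Qed.

Lemma bool_inK (b : bool) c : b -> bool_out (bool_in b c) = c.
Proof. by case: b. Qed.

Lemma bool_in0 (b : bool) : bool_in b 0 = 0.
Proof. by case: b. Qed.

Lemma bool_outK b (w : bool_sp k b) : bool_in b (bool_out w) = w.
Proof. by case: b w => //= w; rewrite [RHS]thinmx0. Qed.

Lemma bool_map_in (b b' : bool) c :
  bool_map k b b' (bool_in b c) = if b then bool_in b' c else 0.
Proof. by case: b b' => [] []. Qed.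

End BoolSpace.

Theorem theorem2 (R : realType) (Q : ctA_quiver R) (k : fieldType)
    (V : rep Q k) (hV : pwf V) :
  exists (J : Type) (I : J -> real_interval R),
    rep_iso V (dsum_rep (fun j : J => itv_rep Q k (I j))).
Proof.
pose n x := sval (cid (hV x)).
(* Since [pwf] gives coordinates only, [V] is transported to row spaces, which are of type
   [vectType]. *)
have exe x : exists ee : {linear V x -> 'rV[k]_(n x)} * {linear 'rV[k]_(n x) -> V x},
    cancel ee.1 ee.2 /\ cancel ee.2 ee.1.
  have [[f lf [f' fK f'K]]] := svalP (cid (hV x)).
  have [F FE] := linear_of lf.
  have [|G GE] := @linear_of k _ (V x) f'.
    by move=> a u v; apply: (can_inj fK); rewrite f'K lf !f'K.
  by exists (F, G); split=> v /=; rewrite FE GE.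
pose e x := (sval (cid (exe x))).1; pose e' x := (sval (cid (exe x))).2.
have eK x : cancel (e x) (e' x) by have [] := svalP (cid (exe x)).
have e'K x : cancel (e' x) (e x) by have [] := svalP (cid (exe x)).
pose W x : vectType k := 'rV[k]_(n x).
pose m x y : 'Hom(W x, W y) := if pselect (qle Q y x) is left h
  then linfun (e y \o rep_map V h \o e' x) else 0.
have mE x y (h : qle Q y x) v : m x y v = e y (rep_map V h (e' x v)).
  rewrite /m; case: pselect => // h'; rewrite lfunE /=.
  by rewrite (Prop_irrelevance h' h).
have mP : linerep_axiom (qle Q) m.
  split=> [x v|x y z yx zy v].
    by rewrite (mE _ _ (qle_refl Q x)) rep_map_id e'K.
  rewrite (mE _ _ (qle_trans zy yx)) (mE _ _ zy) (mE _ _ yx) eK.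
  by rewrite (rep_map_comp (r := V) yx zy (qle_trans zy yx)).
have [J [a [orth sep]]] := summand_decomposition (quiver_line Q) mP.
have /choice[l lP] x := summands_at orth x.
have exI j : exists I : real_interval R, forall x, ri_set I x = sm_I (a j) x.
  have ne : [set x | sm_I (a j) x] !=set0 by apply: sm_nonempty.
  have co : connected [set x | sm_I (a j) x].
    apply/connected_intervalP => x z Ix Iz y /andP[xy yz].
    exact: (sm_convex (s := a j)) xy yz Ix Iz.
  by exists (RealInterval ne co).
have [I IE] : exists I : J -> real_interval R, forall j x, ri_set (I j) x = sm_I (a j) x.
  by exists (fun j => sval (cid (exI j))) => j; apply: svalP (cid (exI j)).
have bE j x : `[< ri_set (I j) x >] = sm_I (a j) x by rewrite IE asboolb.
exists J, I.
pose D := dsum_rep (fun j : J => itv_rep Q k (I j)).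
(* The isomorphism has components [sm_g (a j)]; its inverse combines the [sm_f (a j)] over the
   finite list [l x]. *)
pose Fj x v j : itv_sp k (I j) x := @bool_in k _ (sm_g (a j) x (e x v)).
have Ffin x v : finite_set [set j | Fj x v j != 0].
  apply: (@sub_finite_set _ _ [set j | j \in l x]); last exact: finite_seq.
  move=> j /=; rewrite (lP x).2; apply: contraR => nI.
  by rewrite /Fj bool_in_false ?bE.
pose F x v : D x := DsumMod (Ffin x v).
have Flin x : linear (F x).
  by move=> c u v; apply: dsum_ext => j /=; rewrite -bool_in_linear /Fj !linearP.
have FJ x v j : F x v j = @bool_in k _ (sm_g (a j) x (e x v)) by [].
pose G x (w : D x) : V x :=
  e' x (\sum_(j <- l x) @bool_out k _ ((w : dsum_mod _) j) *: sm_f (a j) x).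
have Glin x : linear (@G x).
  move=> c u v; rewrite /G -linearP scaler_sumr -big_split; congr (e' x _).
  by apply: eq_bigr => j _ /=; rewrite bool_out_linear scalerDl scalerA.
have gsum x (w : D x) i : sm_I (a i) x -> sm_g (a i) x (e x (G x w)) =
    @bool_out k _ ((w : dsum_mod _) i).
  move=> Ii; rewrite /G e'K linear_sum /= (bigD1_seq i) ?(lP x).1 ?(lP x).2 //=.
  rewrite linearZ /= sm_gf // [_ *: _]mulr1 big1_seq ?addr0 // => j /andP[ji _].
  by rewrite linearZ /= orth ?scaler0 // eq_sym.
have GK x : cancel (G x) (F x).
  move=> w; apply: dsum_ext => i; rewrite FJ.
  have [Ii|nIi] := boolP (sm_I (a i) x); first by rewrite gsum // bool_outK.
  rewrite bool_in_false ?bE // -[RHS]bool_outK bool_in_false //.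
  by rewrite bE.
have FK x : cancel (F x) (G x).
  move=> v; apply: (can_inj (eK x)); apply/eqP; rewrite -subr_eq0; apply/eqP.
  apply: sep => i; rewrite linearB /=.
  have [Ii|nIi] := boolP (sm_I (a i) x); last first.
    by rewrite (sm_g0 nIi) !zero_lfunE subrr.
  by rewrite gsum // FJ bool_inK ?bE // subrr.
have Fnat x y (h : qle Q y x) v : F y (rep_map V h v) = rep_map D h (F x v).
  apply: dsum_ext => j; rewrite FJ /=.
  rewrite /itv_map bool_map_in; case: ifPn; rewrite bE => Ix.
    have [Iy|nIy] := boolP (sm_I (a j) y); last by rewrite !bool_in_false ?bE.
    congr bool_in; have /dcohP gc := sm_gcoh (a j).
    by rewrite (gc y x) // (mE _ _ h) eK.
  (* For [y] inside and [x] outside the interval, coherence equates the value at [y] with that of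
     [sm_g (a j) x], which is 0. *)
  have [Iy|nIy] := boolP (sm_I (a j) y); last by rewrite bool_in_false ?bE.
  have /dcohP gc := sm_gcoh (a j).
  have := gc y x Iy isT h (e x v); rewrite (mE _ _ h) eK => <-.
  have -> : sm_g (a j) x (e x v) = 0 by rewrite (sm_g0 Ix) zero_lfunE.
  exact: bool_in0.
pose Fl x : {linear V x -> D x} := sval (cid (linear_of (Flin x))).
have FlE x : Fl x =1 F x by exact: (svalP (cid (linear_of (Flin x)))).
pose Gl x : {linear D x -> V x} := sval (cid (linear_of (Glin x))).
have GlE x : Gl x =1 G x by exact: (svalP (cid (linear_of (Glin x)))).
have Flnat x y (h : qle Q y x) v : Fl y (rep_map V h v) = rep_map D h (Fl x v).
  by rewrite !FlE Fnat.
(* Naturality of the inverse follows from that of [F], which is injective. *)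
have Glnat x y (h : qle Q y x) w : Gl y (rep_map D h w) = rep_map V h (Gl x w).
  by rewrite !GlE; apply: (can_inj (FK y)); rewrite Fnat !GK.
exists (RepHom Flnat), (RepHom Glnat) => x; split=> v /=; rewrite FlE GlE.
  exact: FK.
exact: GK.
Qed.
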